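(* Let $D$ be an arc-locally out-semicomplete digraph. If $D$ does not contain an anti-directed odd cycle as an induced subdigraph, then $D$ is $\alpha$-diperfect.
   Context: All digraphs are finite, without loops and without multiple edges (a pair of opposite edges $uv$, $vu$ is allowed). Two vertices $u,v$ are adjacent if $uv$ or $vu$ is an edge. The underlying graph $U(D)$ is the simple graph on $V(D)$ in which two vertices are joined exactly when they are adjacent in $D$. A source is a vertex with no in-neighbor, a sink is a vertex with no out-neighbor. A digraph $D$ is arc-locally out-semicomplete if for each edge $uv\in E(D)$, every out-neighbor of $u$ and every out-neighbor of $v$ are adjacent or are the same vertex. A digraph $C$ is an anti-directed odd cycle if $U(C)=x_1x_2\dots x_{2k+1}x_1$ is a cycle for some $k\ge 2$, and each of the vertices $x_1,x_2,x_3,x_4,x_6,x_8,\ldots,x_{2k}$ is either a source or a sink of $C$. A stable set is a set of pairwise non-adjacent vertices. A path is a directed path with distinct vertices (a single vertex is a path). A path partition of $D$ is a collection $\mathcal{P}$ of paths of $D$ such that every vertex of $D$ belongs to exactly one path of $\mathcal{P}$. For a stable set $S$ of $D$, an $S$-path partition of $D$ is a path partition $\mathcal{P}$ such that $|V(P)\cap S|=1$ for every $P\in\mathcal{P}$. A digraph satisfies the $\alpha$-property if for every maximum (i.e. maximum cardinality) stable set $S$ it has an $S$-path partition. A digraph is $\alpha$-diperfect if every one of its induced subdigraphs satisfies the $\alpha$-property. *)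

(* Defs.v *)
(* A digraph is a finite type T of vertices with an
   irreflexive arc relation e : rel T (e u v means that uv is an edge), so that
   opposite edges are allowed, while loops and multiple edges are not. *)
From mathcomp Require Import all_boot.

Set Implicit Arguments.
Unset Strict Implicit.
Unset Printing Implicit Defensive.

Section Digraph.
Variables (T : finType) (e : rel T).

(* The edge relation of the underlying graph U(D). *)
Definition adjacent : rel T := [rel u v | e u v || e v u].

Definition source (v : T) : Prop := forall u, ~~ e u v.

Definition sink (v : T) : Prop := forall u, ~~ e v u.

Definition arc_locally_out_semicomplete : Prop :=
  forall u v, e u v -> forall x y, e u x -> e v y -> adjacent x y \/ x = y.

(* x 0, x 1, ..., x n.-1, x 0 is a cycle that is the whole graph g. *)
Definition is_cycle (g : rel T) (n : nat) (x : 'I_n -> T) : Prop :=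
  bijective x /\ forall i j, g (x i) (x j) = (j == ordS i) || (i == ordS j).

(* Indices are shifted by one: the usual x_1, x_2, ..., x_{2k+1} are
   x 0, x 1, ..., x (2k) here, so that x_1, x_2, x_3, x_4 are the x i with i < 4
   and x_2, x_4, x_6, ..., x_{2k} are the x i with i odd. *)
Definition antidirected_odd_cycle : Prop :=
  exists (k : nat) (x : 'I_(2 * k + 1) -> T),
    [/\ 2 <= k, is_cycle adjacent x
      & forall i : 'I_(2 * k + 1), (i < 4) || odd i -> source (x i) \/ sink (x i)].

Definition stable (S : {set T}) : Prop :=
  {in S &, forall u v, ~~ adjacent u v}.

Definition maximum_stable (S : {set T}) : Prop :=
  stable S /\ forall S' : {set T}, stable S' -> #|S'| <= #|S|.

Definition dipath (p : seq T) : bool := [&& p != [::], uniq p & sorted e p].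

Definition path_partition (P : seq (seq T)) : Prop :=
  all dipath P /\ forall v, count (fun p => v \in p) P = 1.

Definition S_path_partition (S : {set T}) (P : seq (seq T)) : Prop :=
  path_partition P /\ {in P, forall p, #|[set v in p] :&: S| = 1}.

Definition alpha_property : Prop :=
  forall S : {set T}, maximum_stable S -> exists P, S_path_partition S P.

Definition induced (A : {set T}) : rel {v : T | v \in A} := relpre val e.

End Digraph.

Definition alpha_diperfect (T : finType) (e : rel T) : Prop :=
  forall A : {set T}, alpha_property (induced e (A := A)).

Definition contains_induced_antidirected_odd_cycle
    (T : finType) (e : rel T) : Prop :=
  exists A : {set T}, antidirected_odd_cycle (induced e (A := A)).

(* Main.v *)
(* Let S be a maximum stable set of D, and call an induced directed cycle of odd
   length at least 5 an odd dicycle.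

   If D has no odd dicycle, its underlying graph is perfect.  Colour it with as
   many colours as its largest clique has vertices, by induction: the
   out-neighbours of a vertex without in-neighbours form a clique joined to a
   stable set, which Kempe changes make monochromatic.  One may assume that no
   two non-adjacent vertices x, y have N(x) contained in N(y), as x can then get
   the colour of y.  If every vertex has an in-neighbour, an initial strong
   component dominates all its exits, and these form a clique; if D is strong, it
   is bipartite or has an odd dicycle or a universal vertex.  By the weak perfect
   graph theorem D is then partitioned into |S| cliques, which have Hamiltonian
   paths.

   Otherwise blow up an odd dicycle to a largest extended cycle A_0, ..., A_(n-1).
   An out-neighbour of A outside A is dominated by all of A.  If it is not in
   S, a path partition of the rest can be extended to it; if it is, S does not
   meet A, and with |A_(i+1)| <= |A_i| the vertices of A_(i+1) can be appended to
   those of A_i in a path partition of the rest.  So no arc leaves A, and one may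
   assume that every vertex reaches A.  As n is odd, S misses A_(j+1) and A_(j+2)
   for some j, and one may assume |A_j| < |A_(j+1)|.  Adding all edges between
   A_j and A_(j+2) yields a perfect graph, hence a partition into |S| cliques.
   The only cliques which are not paths of D are pairs {a, c} with a in A_j and
   c in A_(j+2), and by |A_j| < |A_(j+1)| there are enough vertices b of A_(j+1) to
   turn them into paths a b c. *)
Require Import Defs.
From mathcomp Require Import all_boot all_algebra zify.
From Stdlib Require Import Classical.

Set Implicit Arguments.
Unset Strict Implicit.
Unset Printing Implicit Defensive.

(** * Perfect graphs *)

Section PerfectGraphs.
Variables (T : finType) (g : rel T).

Definition independent (S : {set T}) : Prop := {in S &, forall x y, ~~ g x y}.

Definition clique (K : {set T}) : Prop := {in K &, forall x y, x != y -> g x y}.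

Definition colouring (U : {set T}) (m : nat) (c : T -> nat) : Prop :=
  {in U, forall x, c x < m} /\ {in U &, forall x y, g x y -> c x != c y}.

Definition cliques_bounded (U : {set T}) (m : nat) : Prop :=
  forall K : {set T}, K \subset U -> clique K -> #|K| <= m.

Definition perfect (U : {set T}) : Prop :=
  forall (H : {set T}) m, H \subset U -> cliques_bounded H m ->
  exists c, colouring H m c.

Definition maximum_independent (U S : {set T}) : Prop :=
  [/\ S \subset U, independent S
    & forall S' : {set T}, S' \subset U -> independent S' -> #|S'| <= #|S|].

Lemma independentS (A B : {set T}) : A \subset B -> independent B -> independent A.
Proof. by move=> /subsetP sAB iB x y /sAB xB /sAB yB; apply: iB. Qed.

Lemma clique_independent_le1 (K S : {set T}) :
  clique K -> independent S -> #|K :&: S| <= 1.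
Proof.
move=> cK iS; rewrite leqNgt; apply/negP => /card_gt1P[x [y [xI yI xy]]].
move: xI yI; rewrite !inE => /andP[xK xS] /andP[yK yS].
by move: (iS x y xS yS); rewrite cK.
Qed.

Lemma sum_mem_card (K X : {set T}) : \sum_(x in K) (x \in X) = #|K :&: X|.
Proof.
rewrite -sum1_card [RHS](eq_bigl (fun x => (x \in K) && (x \in X))); last first.
  by move=> x; rewrite inE.
by rewrite [RHS]big_mkcondr; apply: eq_bigr => x _; case: (x \in X).
Qed.

Lemma sum_card_meet (I : Type) (L : seq I) (P : pred I) (F : I -> {set T})
    (K : {set T}) :
  \sum_(x in K) \sum_(i <- L | P i) (x \in F i) = \sum_(i <- L | P i) #|K :&: F i|.
Proof. by rewrite exchange_big; apply: eq_bigr => i _; apply: sum_mem_card. Qed.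

(* Lovasz's replication lemma, with multiplicities in place of replicated
   vertices. *)
Lemma perfect_weighted_colouring (U : {set T}) (w : T -> nat) m :
  perfect U -> (forall x, x \notin U -> w x = 0) ->
  (forall K : {set T}, K \subset U -> clique K -> \sum_(x in K) w x <= m) ->
  exists L : seq {set T}, [/\ size L = m, {in L, forall X, independent X}
    & forall x, w x <= \sum_(X <- L) (x \in X)].
Proof.
move=> perfU; have [N] := ubnP (\sum_x w x).
elim: N => // N IH in w m *; rewrite ltnS => wN w0 wK.
(* With all weights at most 1 this is an ordinary colouring of the support [H]. *)
case: (boolP [forall x, w x <= 1]) => [/forallP w1|].
  pose H := [set x | w x == 1].
  have HU : H \subset U.
    by apply/subsetP => x; rewrite inE; apply: contraTT => /w0 ->.
  have [|c [cm cP]] := perfU H m HU.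
    move=> K KH cK; have := wK K (subset_trans KH HU) cK.
    suff -> : \sum_(x in K) w x = #|K| by [].
    rewrite -sum1_card; apply: eq_bigr => x /(subsetP KH).
    by rewrite inE => /eqP.
  exists [seq [set x in H | c x == k] | k <- iota 0 m].
  split; rewrite ?size_map ?size_iota //.
    move=> X /mapP[k _ ->] x y; rewrite !inE => /andP[xH /eqP cx] /andP[yH /eqP cy].
    by apply/negP => /cP; rewrite !inE cx cy eqxx => /(_ xH yH).
  move=> x; case: (posnP (w x)) => [-> //|wx]; rewrite big_map.
  have xH : x \in H by rewrite inE; have := w1 x; lia.
  rewrite (big_rem (c x)) /=; last by rewrite mem_iota; apply: cm.
  by rewrite !inE in xH *; rewrite xH eqxx (eqP xH).
rewrite negb_forall => /existsP[x]; rewrite -ltnNge => wx.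
pose w1 y := w y - (y == x).
have sum1 (K : {set T}) : x \in K -> \sum_(y in K) w y = (\sum_(y in K) w1 y).+1.
  move=> xK; rewrite (bigD1 x) //= [in RHS](bigD1 x) //= {1}/w1 eqxx.
  rewrite (eq_bigr w1) => [|y /andP[_ /negPf yx]]; last by rewrite /w1 yx subn0.
  lia.
have sumT : \sum_y w y = (\sum_y w1 y).+1.
  have E (F : T -> nat) : \sum_(y in [set: T]) F y = \sum_y F y.
    by apply: eq_bigl => y; rewrite inE.
  by have := sum1 setT (in_setT x); rewrite !E.
have le1 y : w1 y <= w y by rewrite /w1 leq_subr.
have [| | |L1 [sL1 iL1 cL1]] := IH w1 m.
- lia.
- by move=> y /w0 wy; rewrite /w1 wy.
- move=> K KU cK; apply: leq_trans (wK K KU cK).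
  by apply: leq_sum => y _; apply: le1.
have [X XL1 xX] : exists2 X, X \in L1 & x \in X.
  have := cL1 x; rewrite /w1 eqxx => wx1.
  have : has (fun X : {set T} => x \in X) L1.
    apply/negP; move/negP/hasPn => nX.
    move: wx1; rewrite big_seq big1 => [|Y /nX /negPf -> //]; lia.
  by move/hasP => [X]; exists X.
(* One copy of [x] is served by [X], whose other vertices lose one unit. A clique through [x]
   already has [w1]-weight at most [m - 1]; one avoiding [x] meets each of the [m - 1] sets of
   [rem X L1] at most once. *)
pose w2 y := w1 y - ((y \in X) && (y != x)).
have le2 y : w2 y <= w1 y by rewrite /w2 leq_subr.
have m1 : 0 < m by rewrite -sL1; case: (L1) XL1.
have [| | |L2 [sL2 iL2 cL2]] := IH w2 m.-1.
- apply: leq_ltn_trans (_ : \sum_y w1 y < _); last by lia.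
  by apply: leq_sum => y _; apply: le2.
- by move=> y /w0 wy; rewrite /w2 /w1 wy.
- move=> K KU cK; have [xK|xK] := boolP (x \in K).
    have := wK K KU cK; rewrite (sum1 K xK) => wKm.
    have : \sum_(y in K) w2 y <= \sum_(y in K) w1 y by apply: leq_sum.
    lia.
  have le3 : \sum_(y in K) w2 y <= \sum_(y in K) \sum_(Y <- rem X L1) (y \in Y).
    apply: leq_sum => y yK; have := cL1 y; rewrite (big_rem X) //= /w2.
    have -> : (y != x) by apply: contraNneq xK => <-.
    rewrite andbT; lia.
  apply: leq_trans le3 _; rewrite sum_card_meet.
  apply: leq_trans (_ : \sum_(Y <- rem X L1) 1 <= _).
    rewrite !big_seq; apply: leq_sum => Y /mem_rem YL.
    by apply: clique_independent_le1 => //; apply: iL1.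
  by rewrite sum1_size size_rem // sL1.
exists (X :: L2); split => [|Y|y] /=.
- by rewrite sL2 prednK.
- by rewrite inE => /orP[/eqP -> | /iL2 //]; apply: iL1.
rewrite big_cons; have := cL2 y; rewrite /w2 /w1.
by have [->|yx] := eqVneq y x; rewrite ?xX /= ; lia.
Qed.

Hypothesis girr : irreflexive g.

(** Otherwise each clique [K] is missed by some maximum independent set [F K]. Weight a vertex by
    the number of sets [F K] containing it: every clique then has weight at most [#|cl| - 1], so
    that many independent sets cover the weights, although the total weight is [#|cl| * #|S|]. *)
Lemma perfect_clique_meeting_maximum_sets (U S : {set T}) :
  perfect U -> maximum_independent U S -> U != set0 ->
  exists K : {set T}, [/\ K \subset U, clique K &
    forall S', maximum_independent U S' -> K :&: S' != set0].
Proof.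
move=> perfU [SU iS maxS] Un0; apply: NNPP => noK.
pose cl := [set K : {set T} | (K \subset U) &&
  [forall x in K, forall y in K, (x != y) ==> g x y]].
have clP (K : {set T}) : reflect (K \subset U /\ clique K) (K \in cl).
  rewrite inE; apply: (iffP andP) => -[KU cK]; split=> //.
    by move=> x y xK yK; move/forall_inP/(_ x xK)/forall_inP/(_ y yK)/implyP: cK.
  apply/forall_inP => x xK; apply/forall_inP => y yK; apply/implyP.
  exact: cK.
have /fin_all_exists[F FP] (K : {set T}) : exists S' : {set T},
    K \in cl -> maximum_independent U S' /\ K :&: S' = set0.
  have [Kcl|_] := boolP (K \in cl); last by exists set0.
  apply: NNPP => nS; apply: noK; move/clP: Kcl => [KU cK].
  exists K; split=> // S' mS'; apply/negP => /eqP KS'.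
  by apply: nS; exists S'.
have [x0 x0U] := set0Pn _ Un0.
have S1 : 0 < #|S|.
  rewrite -(cards1 x0); apply: maxS; first by rewrite sub1set.
  by move=> y z; rewrite !inE => /eqP -> /eqP ->; rewrite girr.
have cardF (K : {set T}) : K \in cl -> #|F K| = #|S|.
  move=> /FP[[FU iF mF] _]; apply/eqP; rewrite eqn_leq maxS // andTb; exact: mF.
pose w x := \sum_(K in cl) (x \in F K).
have cl0 : set0 \in cl by apply/clP; split=> [|x y]; rewrite ?sub0set ?inE.
have clgt0 : 0 < #|cl| by apply/card_gt0P; exists set0.
have sumw (X : {set T}) : \sum_(x in X) w x = \sum_(K in cl) #|X :&: F K|.
  exact: sum_card_meet.
have [| |L [sL iL cL]] := @perfect_weighted_colouring U w #|cl|.-1 perfU.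
- move=> x xU; apply: big1 => K /FP[[FU _ _] _].
  by case: (boolP (x \in F K)) => // /(subsetP FU); rewrite (negPf xU).
- move=> K KU cK; rewrite sumw (bigD1 K) /=; last exact/clP.
  have /FP[_ ->] : K \in cl by apply/clP.
  rewrite cards0 add0n; apply: leq_trans (_ : \sum_(K' in cl | K' != K) 1 <= _).
    apply: leq_sum => K' /andP[/FP[[_ iF _] _] _].
    exact: clique_independent_le1.
  have KK : K \in cl by apply/clP.
  rewrite sum1_card (cardD1 K (mem cl)) KK /=.
  rewrite add0n; apply: subset_leq_card; apply/subsetP => K'.
  by rewrite unfold_in => /andP[Kcl KK']; apply/andP.
have le1 : \sum_(x in U) w x <= \sum_(x in U) \sum_(X <- L) (x \in X).
  by apply: leq_sum => x _; apply: cL.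
move: le1; rewrite sum_card_meet sumw.
have -> : \sum_(K in cl) #|U :&: F K| = #|cl| * #|S|.
  rewrite -sum_nat_const; apply: eq_bigr => K Kcl.
  have [[FU _ _] _] := FP K Kcl.
  by rewrite (setIidPr FU) cardF.
have : \sum_(X <- L) #|U :&: X| <= \sum_(X <- L) #|S|.
  rewrite !big_seq; apply: leq_sum => X XL; apply: maxS; first exact: subsetIl.
  by apply: independentS (iL X XL); apply: subsetIr.
rewrite big_const_seq count_predT iter_addn_0 sL.
move: clgt0 S1; move: (\sum_(X <- L) _) => a.
case: #|cl| => // k _; rewrite /= mulSn mulnC; lia.
Qed.

(* The weak perfect graph theorem: the fibres of f are the cliques. *)
Lemma perfect_clique_partition (U S : {set T}) :
  perfect U -> maximum_independent U S ->
  exists f : T -> T, [/\ {in U, forall v, f v \in S}, {in S, forall s, f s = s}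
    & {in U &, forall u v, f u = f v -> u != v -> g u v}].
Proof.
have [N] := ubnP #|U|; elim: N => // N IH in U S *; rewrite ltnS => UN.
move=> perfU mS; have [SU iS maxS] := mS.
have [U0|Un0] := eqVneq U set0.
  exists id; split=> // v; rewrite U0 ?inE //.
have [K [KU cK meetK]] := perfect_clique_meeting_maximum_sets perfU mS Un0.
have [s] := set0Pn _ (meetK S mS); rewrite inE => /andP[sK sS].
have KS t : t \in K -> t \in S -> t = s.
  move=> tK tS; apply/eqP; apply: contraTT isT => ts.
  by have := iS t s tS sS; rewrite cK.
have sU : s \in U by apply: (subsetP KU).
have UKlt : #|U :\: K| < #|U|.
  apply: proper_card; apply/properP; split; first exact: subsetDl.
  by exists s => //; rewrite inE sK.
have cardS : #|S :\ s| = #|S|.-1 by rewrite (cardsD1 s S) sS.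
have Sgt0 : 0 < #|S| by apply/card_gt0P; exists s.
have [| | |f [f1 f2 f3]] := IH (U :\: K) (S :\ s).
- lia.
- by move=> H m HU; apply: perfU; apply: subset_trans HU (subsetDl _ _).
- split.
  + apply/subsetP => t; rewrite !inE => /andP[ts tS].
    rewrite (subsetP SU) // andbT; apply: contra ts => tK.
    by rewrite (KS t tK tS).
  + exact: independentS (subsetDl _ _) iS.
  (* A set of size [#|S|] avoiding [K] would be maximum in [U], contrary to the choice of [K]. *)
  + move=> S' S'U iS'; rewrite cardS -ltnS prednK //.
    have S'U1 : S' \subset U by apply: subset_trans S'U (subsetDl _ _).
    rewrite ltn_neqAle maxS // andbT; apply/eqP => eqS.
    have mS' : maximum_independent U S' by split=> // S'' a b; rewrite eqS maxS.
    have [t] := set0Pn _ (meetK S' mS'); rewrite inE => /andP[tK tS'].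
    by have := subsetP S'U t tS'; rewrite inE tK.
exists (fun v => if v \in K then s else f v); split.
- move=> v vU; case: ifP => // vK.
  by have := f1 v; rewrite !inE vK vU => /(_ isT)/andP[].
- move=> t tS; case: ifP => [tK|tK]; first by rewrite (KS t tK tS).
  by apply: f2; rewrite !inE tS andbT; apply: contraFneq tK => ->.
- move=> u v uU vU; case: ifP => uK; case: ifP => vK.
  + by move=> _; apply: cK.
  + by move=> fv; have := f1 v; rewrite !inE vK vU -fv eqxx => /(_ isT).
  + by move=> fu; have := f1 u; rewrite !inE uK uU fu eqxx => /(_ isT).
  + by apply: f3; rewrite inE ?uK ?vK.
Qed.

End PerfectGraphs.

(** * Extending colourings *)

Section Colourings.
Variables (T : finType) (g : rel T).
Hypotheses (girr : irreflexive g) (gsym : symmetric g).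

Lemma cliques_boundedS (A B : {set T}) m :
  A \subset B -> cliques_bounded g B m -> cliques_bounded g A m.
Proof. by move=> AB bB K KA; apply: bB; apply: subset_trans AB. Qed.

Lemma colouring_dominated (U : {set T}) m c x y :
  x \in U -> y \in U -> x != y -> ~~ g x y ->
  {in U, forall z, g z x -> g z y} ->
  colouring g (U :\ x) m c -> exists c', colouring g U m c'.
Proof.
move=> xU yU xy nxy dom [cm cP]; exists (fun z => if z == x then c y else c z).
have yUx : y \in U :\ x by rewrite !inE eq_sym xy.
split=> [z zU|z1 z2 z1U z2U].
  by case: eqVneq => [_|zx]; [apply: cm | apply: cm; rewrite !inE zx].
have [->|z1x] := eqVneq z1 x; have [->|z2x] := eqVneq z2 x.
- by rewrite girr.
- rewrite gsym => /(dom _ z2U); rewrite gsym; apply: cP => //.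
  by rewrite !inE z2x.
- by move=> /(dom _ z1U); apply: cP => //; rewrite !inE z1x.
- by apply: cP; rewrite !inE ?z1x ?z2x.
Qed.

Lemma colouring_join (U C E : {set T}) m c :
  C \subset U -> E \subset U :\: C -> clique g E ->
  {in C & E, forall x y, g x y} ->
  {in C & U :\: C, forall x y, g x y -> y \in E} ->
  cliques_bounded g U m -> colouring g (U :\: C) m c ->
  (forall m', cliques_bounded g C m' -> exists c', colouring g C m' c') ->
  exists c', colouring g U m c'.
Proof.
move=> CU EU cE jCE nCE bU [cm cP] colC.
pose s := [seq c x | x <- enum E].
pose l := [seq k <- iota 0 m | k \notin s].
have sl : m - #|E| <= size l.
  have := count_predC (mem s) (iota 0 m); rewrite size_iota => em.
  have : count (mem s) (iota 0 m) <= #|E|.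
    rewrite -size_filter cardE -(size_map c); apply: uniq_leq_size.
      by rewrite filter_uniq ?iota_uniq.
    by move=> k; rewrite mem_filter => /andP[].
  have -> : size l = count (predC (mem s)) (iota 0 m) by rewrite size_filter.
  lia.
have [|d [dm dP]] := colC (m - #|E|).
  move=> K KC cK.
  have dKE : [disjoint K & E].
    rewrite -setI_eq0; apply/eqP/setP => x; rewrite !inE.
    apply/negP => /andP[/(subsetP KC) xC /(subsetP EU)].
    by rewrite inE xC.
  have : #|K :|: E| <= m.
    apply: bU; first by rewrite subUset (subset_trans KC) //=;
      apply: subset_trans EU (subsetDl _ _).
    move=> x y; rewrite !inE => /orP[xK|xE] /orP[yK|yE] xy.
    - exact: cK.
    - by apply: jCE => //; apply: (subsetP KC).
    - by rewrite gsym; apply: jCE => //; apply: (subsetP KC).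
    - exact: cE.
  move: dKE; rewrite -leq_card_setU => /eqP -> ; lia.
have inl x : x \in C -> nth 0 l (d x) \in l.
  by move=> xC; apply: mem_nth; apply: leq_trans (dm x xC) sl.
have sep x y : x \in C -> y \in U -> y \notin C -> g x y ->
    nth 0 l (d x) != c y.
  move=> xC yU yC gxy; apply/eqP => dc; have := inl x xC.
  rewrite dc mem_filter map_f // mem_enum.
  by apply: (nCE x y) => //; rewrite !inE yC.
exists (fun x => if x \in C then nth 0 l (d x) else c x); split.
  move=> x xU; case: ifP => xC; last by apply: cm; rewrite !inE xC.
  by have := inl x xC; rewrite mem_filter mem_iota => /andP[_].
move=> x y xU yU; case: ifP => xC; case: ifP => yC gxy.
- rewrite nth_uniq ?filter_uniq ?iota_uniq //.
  + exact: dP.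
  + exact: leq_trans (dm x xC) sl.
  + exact: leq_trans (dm y yC) sl.
- by apply: sep; rewrite ?yC.
- by rewrite eq_sym; apply: sep; rewrite ?xC // gsym.
- by apply: cP; rewrite ?inE ?xC ?yC.
Qed.

End Colourings.

(** * Digraphs without induced odd directed cycles *)

Section OutSemicomplete.
Variables (T : finType) (e : rel T).
Hypothesis eirr : irreflexive e.
Hypothesis eout : arc_locally_out_semicomplete e.
Local Notation adj := (adjacent e).

Definition near x y := (x == y) || adj x y.

Lemma adjxx : irreflexive adj.
Proof. by move=> x; rewrite /adjacent /= eirr. Qed.

Lemma adj_sym : symmetric adj.
Proof. by move=> x y; rewrite /adjacent /= orbC. Qed.

Lemma arc_adj x y : e x y -> adj x y.
Proof. by rewrite /adjacent /= => ->. Qed.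

Lemma arc_adjC x y : e x y -> adj y x.
Proof. by rewrite /adjacent /= => ->; rewrite orbT. Qed.

Lemma adj_neq x y : adj x y -> x != y.
Proof. by apply: contraTneq => ->; rewrite adjxx. Qed.

Lemma arc_neq x y : e x y -> x != y.
Proof. by move/arc_adj/adj_neq. Qed.

Lemma near_refl x : near x x.
Proof. by rewrite /near eqxx. Qed.

Lemma near_sym : symmetric near.
Proof. by move=> x y; rewrite /near eq_sym adj_sym. Qed.

Lemma adj_near x y : adj x y -> near x y.
Proof. by rewrite /near => ->; rewrite orbT. Qed.

Lemma near_adj x y : near x y -> x != y -> adj x y.
Proof. by rewrite /near => /orP[->|]. Qed.

Lemma near_cases x y : near x y -> [\/ x = y, e x y | e y x].
Proof.
by case/orP => [/eqP -> |/orP[xy|yx]]; [constructor 1|constructor 2|constructor 3].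
Qed.

Lemma out_near u v x y : e u v -> e u x -> e v y -> near x y.
Proof.
move=> uv ux vy; case: (eout uv ux vy) => [|->]; last exact: near_refl.
exact: adj_near.
Qed.

Lemma adj_out_near u v x y : adj u v -> e u x -> e v y -> near x y.
Proof.
case/orP => [uv|vu] ux vy; first exact: (out_near uv).
by rewrite near_sym; apply: (out_near vu).
Qed.

(** * Odd closed walks and induced odd directed cycles *)

Definition induced_odd_dicycle (U : {set T}) : Prop :=
  exists n (c : nat -> T), [/\ odd n, 5 <= n, forall k, c k \in U
    & forall i j, e (c i) (c j) = (j == i.+1 %[mod n])].

Lemma induced_odd_dicycleS (A B : {set T}) :
  A \subset B -> induced_odd_dicycle A -> induced_odd_dicycle B.
Proof.
move=> /subsetP AB [n [c [on n5 cA ec]]]; exists n, c.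
by split=> // k; apply: AB.
Qed.

Definition triangle_free (U : {set T}) : Prop :=
  {in U & U & U, forall x y z, ~~ [&& adj x y, adj y z & adj x z]}.

(** A shortest odd closed walk is induced: a repeated vertex or a chord of odd span yields a shorter
    odd closed walk. *)
Lemma odd_closed_walk_induced (U : {set T}) n (c : nat -> T) :
  triangle_free U -> odd n -> (forall k, c k \in U) ->
  (forall k, e (c k) (c k.+1)) -> (forall k, c (k + n) = c k) ->
  induced_odd_dicycle U.
Proof.
move=> tf; elim/ltn_ind: n => n IH in c *.
move=> on cU cS cn; apply: NNPP => noU.
have short a b : a <= b -> e (c b) (c a) -> odd (b - a).+1 ->
    (b - a).+1 < n -> False.
  move=> ab eba odd_len lt; apply: noU.
  apply: (IH _ lt (fun k => c (a + k %% (b - a).+1))) => // k.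
  - have := ltn_pmod k (ltn0Sn (b - a)); set d := (b - a).+1 => lk.
    rewrite -(addn1 k) -modnDml; have [E|ne] := eqVneq (k %% d).+1 d.
      rewrite addn1 E modnn addn0; have -> : a + k %% d = b by lia.
      exact: eba.
    by rewrite (@modn_small (k %% d + 1)) addn1 ?addnS //; lia.
  - by rewrite modnDr.
have c_neq i j : i < j < i + n -> c i != c j.
  move=> /andP[ij jn]; apply/eqP => cij.
  have [od|ev] := boolP (odd (j - i)).
    apply: (short i j.-1); [lia| |lia|lia].
    by rewrite cij; have := cS j.-1; rewrite prednK //; lia.
  apply: (short j (i + n).-1); [lia| |lia|lia].
  rewrite -cij -(cn i); have := cS (i + n).-1; rewrite prednK //; lia.
have c_arc d : forall i, 1 < d < n -> ~~ e (c i) (c (i + d)).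
  elim/ltn_ind: d => d IHd i /andP[d1 dn]; apply/negP => eij.
  have [od|ev] := boolP (odd d).
    by apply: (short (i + d) (i + n)); [lia|rewrite cn|lia|lia].
  (* For even span [d > 2] an arc from [c (i + d)] to [c i.+2] closes an odd walk of length [d - 1],
     and the opposite arc is a chord of span [d - 2]. *)
  have nr : near (c (i + d)) (c i.+2).
    exact: (out_near (cS i) eij (cS i.+1)).
  have [d2|d2] := eqVneq d 2.
    have := tf _ _ _ (cU i) (cU i.+1) (cU (i + d)).
    move: eij; rewrite d2 addn2 => eij.
    by rewrite (arc_adj (cS i)) (arc_adj (cS i.+1)) (arc_adj eij).
  case: (near_cases nr) => [E|E|E].
  - have := @c_neq i.+2 (i + d); rewrite E eqxx => /(_ ltac:(lia)) //.
  - by apply: (short i.+2 (i + d)); [lia| |lia|lia].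
  - have : 1 < d - 2 < n by lia.
    move=> /(IHd (d - 2) ltac:(lia) i.+2)/negP; apply.
    by have -> : i.+2 + (d - 2) = i + d by lia.
have cmod k : c (k %% n) = c k.
  rewrite {2}(divn_eq k n); elim: (k %/ n) => [//|q ->].
  by have -> : q.+1 * n + k %% n = q * n + k %% n + n by lia; rewrite cn.
have n5 : 5 <= n.
  case: n on cn cU cS {IH short c_neq c_arc cmod} => [|[|[|[|[|n]]]]] // _ cn cU cS.
    by have := cS 0; rewrite -(cn 0) eirr.
  have := tf _ _ _ (cU 0) (cU 1) (cU 2).
  rewrite (arc_adj (cS 0)) (arc_adj (cS 1)).
  by have := cS 2; rewrite -[3]/(0 + 3) cn => /arc_adjC ->.
apply: noU; exists n, c; split=> // i j; apply/idP/idP => [eij|/eqP ij]; last first.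
  by rewrite -(cmod j) ij cmod.
have n0 : 0 < n by lia.
move: eij; rewrite -(cmod i) -(cmod j) => eij.
rewrite -[j]/(0 + j) -(modnDmr 0 j) -addn1 -(modnDml i 1) add0n.
move: (ltn_pmod i n0) (ltn_pmod j n0) eij.
move: (i %% n) (j %% n) => {}i {}j ilt jlt eij.
have [ji|ij|ij] := ltngtP j i.
- rewrite -(modnDr j n); have := @c_arc (j + n - i) i.
  have -> : i + (j + n - i) = j + n by lia.
  rewrite cn eij /= => na; have : ~ (1 < j + n - i < n) by move/na.
  by move=> lt; have -> : j + n = i + 1 by lia.
- have := @c_arc (j - i) i; rewrite subnKC ?(ltnW ij) // eij /=.
  move=> na; have : ~ (1 < j - i < n) by move/na.
  by move=> lt; have -> : j = i + 1 by lia.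
- by move: eij; rewrite ij eirr.
Qed.

(* Kempe chains cannot join two non-adjacent out-neighbours of different
   colours: along such a chain p 0, ..., p l the arcs enter the vertices of
   even index, since two consecutive arcs towards p 0 force all later arcs to
   point towards p 0. *)
Lemma no_kempe_chain (c : T -> nat) (a b : nat) u l (p : nat -> T) :
  a != b -> odd l ->
  (forall k, k <= l -> c (p k) = if odd k then b else a) ->
  (forall j k, j <= l -> k <= l -> adj (p j) (p k) -> c (p j) != c (p k)) ->
  (forall k, k < l -> adj (p k) (p k.+1)) ->
  e u (p 0) -> e u (p l) -> ~~ adj (p 0) (p l) -> False.
Proof.
move=> ab; elim/ltn_ind: l => l IH in p *.
move=> ol pc pP pa up0 upl na.
have l3 : 3 <= l.
  have : l != 1 by apply: contraNneq na => l1; rewrite l1 pa // l1.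
  by case: (l) ol => [|[|[|k]]].
have cneq j k : j <= l -> k <= l -> odd j != odd k -> p j != p k.
  move=> jl kl ne; apply: contraNneq ab => E.
  have := congr1 c E; rewrite !pc //.
  by move: ne; case: (odd j); case: (odd k) => // _ ->.
(* Skipping [p (k + 1)] and [p (k + 2)] would leave a shorter chain with the same alternation of
   colours. *)
have near3 k : k + 3 <= l -> ~~ near (p k) (p (k + 3)).
  move=> kl; apply/negP => /orP[|akk].
    by apply/negP/cneq; [lia|lia|rewrite oddD; case: (odd k)].
  apply: (IH (l - 2) ltac:(lia) (fun i => if i <= k then p i else p (i + 2))) => //.
  - lia.
  - move=> i il; case: ifP => ik; rewrite pc ?oddD ?addbF //; lia.
  - by move=> i j il jl; case: ifP => ik; case: ifP => jk; apply: pP; lia.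
  - move=> i il; have [ik|ik|ik] := ltngtP i k.
    + by rewrite pa //; lia.
    + by rewrite addSn pa //; lia.
    + by rewrite ik addSn addn2 -addn3.
  - by have -> : (l - 2 <= k) = false; [lia|rewrite subnK //; lia].
  - by have -> : (l - 2 <= k) = false; [lia|rewrite subnK //; lia].
have odd_adj j k : j <= l -> k <= l -> adj (p j) (p k) -> odd j != odd k.
  move=> jl kl /(pP j k jl kl); apply: contraNneq => jk.
  by rewrite !pc // jk.
have arc_or k : k < l -> ~~ e (p k) (p k.+1) -> e (p k.+1) (p k).
  by move=> /pa; rewrite /adjacent /= => /orP[->|].
(* Both ends are out-neighbours of [u], so this arc would make [p 1] and [p l] near, though both
   have colour [b]. The other end is symmetric. *)
have first : ~~ e (p 0) (p 1).
  apply/negP => e01; case/orP: (out_near up0 upl e01) => [/eqP E|].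
    by move: na; rewrite E pa //; lia.
  by move/odd_adj; rewrite ol => /(_ (leqnn l) ltac:(lia)).
have last : ~~ e (p l) (p l.-1).
  apply/negP => el; have lp : l = l.-1.+1 by lia.
  case/orP: (out_near upl up0 el) => [/eqP E|].
    by move: na; rewrite E {2}lp pa //; lia.
  move/odd_adj => /(_ ltac:(lia) ltac:(lia)); lia.
have back k : k.+2 <= l -> e (p k.+1) (p k) -> e (p k.+2) (p k.+1) ->
    False.
  move=> kl e1 e2; apply/negP: last; rewrite negbK.
  suff H j : k + j.+2 <= l -> e (p (k + j).+1) (p (k + j)) /\
      e (p (k + j).+2) (p (k + j).+1).
    have := H (l - k.+2) ltac:(clear -kl; lia);
    have -> : (k + (l - k.+2)).+1 = l.-1 by clear -kl; lia.
    by rewrite (_ : l.-1.+1 = l); [case|clear -kl; lia].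
  elim: j => [|j IHj] jl; first by rewrite addn0.
  have [e3 e4] := IHj ltac:(clear -jl; lia); rewrite addnS; split=> //.
  apply: arc_or; first by clear -jl; lia.
  apply: contra (near3 (k + j) ltac:(clear -jl; lia)) => e5.
  by rewrite near_sym addn3; apply: (out_near e4 e5 e3).
have step k : k < l -> if odd k then ~~ e (p k.+1) (p k) else ~~ e (p k) (p k.+1).
  elim/ltn_ind: k => -[//|k] IHk kl.
  have := IHk k ltac:(clear -kl; lia) ltac:(clear -kl; lia).
  rewrite /= if_neg; case: ifP => ok H; last first.
    by apply/negP => e2; apply: (back k) => //; apply: arc_or => //; clear -kl; lia.
  have e1 : e (p k) (p k.+1).
    by have := pa k ltac:(clear -kl; lia); rewrite /adjacent /= (negPf H) orbF.
  case: k => [//|k] in IHk kl ok H e1 *.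
  have := IHk k ltac:(clear -kl; lia) ltac:(clear -kl; lia).
  rewrite (negPf (ok : ~~ odd k)).
  move/(arc_or k ltac:(clear -kl; lia)) => e0.
  apply: contra (near3 k ltac:(clear -kl; lia)) => e2.
  by rewrite addn3; apply: (out_near e1 e0 e2).
have := step l.-1 ltac:(lia); have -> : odd l.-1 = false by lia.
have -> : l.-1.+1 = l by lia.
move=> H; have := arc_or l.-1 ltac:(lia); have -> : l.-1.+1 = l by lia.
by rewrite (negPf last) => /(_ H).
Qed.

(** * Kempe changes around a source *)

Lemma connect_preserved (r : rel T) (P : T -> Prop) x y :
  P x -> (forall a b, P a -> r a b -> P b) -> connect r x y -> P y.
Proof.
move=> Px step /connectP[s rs ->]; elim: s x Px rs => [//|z s IH] x Px /=.
by case/andP => /(step x z Px); apply: IH.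
Qed.

(** The out-neighbours of [u] split into [W], whose members are near all of them, and an independent
    set [Q]. Once [Q] is monochromatic, the colours around [u] are those of a clique, and one is
    left for [u]. *)
Lemma colouring_source (U : {set T}) m u c :
  u \in U -> {in U, forall v, ~~ e v u} -> cliques_bounded adj U m ->
  colouring adj (U :\ u) m c -> exists c', colouring adj U m c'.
Proof.
move=> uU src bU col.
pose N := [set v in U | e u v].
have NP v : reflect (v \in U /\ e u v) (v \in N) by rewrite inE; apply: andP.
(* If a clique [K] shows all colours of [N], then [u |: K] is a clique, so [#|K| < m] and some
   colour is free. *)
have finish c1 (K : {set T}) : colouring adj (U :\ u) m c1 -> K \subset N ->
    clique adj K -> {in N, forall x, exists2 y, y \in K & c1 x = c1 y} ->
    exists c', colouring adj U m c'.
  move=> [cm cP] KN cK NK.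
  have Ku : #|u |: K| <= m.
    apply: bU.
      rewrite subUset sub1set uU /=; apply: subset_trans KN _.
      by apply/subsetP => x /NP[].
    move=> x y; rewrite !inE => /orP[/eqP ->|xK] /orP[/eqP ->|yK]; last exact: cK.
    - by rewrite eqxx.
    - by have /NP[_ /arc_adj] := subsetP KN y yK.
    - by have /NP[_ /arc_adjC] := subsetP KN x xK.
  have uK : u \notin K.
    by apply/negP => /(subsetP KN)/NP[_]; rewrite eirr.
  rewrite cardsU1 uK add1n in Ku.
  have [k km kK] : exists2 k, k < m & k \notin [seq c1 x | x <- enum K].
    apply: NNPP => no; have := @uniq_leq_size _ (iota 0 m) [seq c1 x | x <- enum K].
    rewrite iota_uniq size_iota size_map -cardE => H.
    have : m <= #|K|.
      apply: H => // k; rewrite mem_iota add0n => /andP[_ km].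
      by apply: contraT => kK; case: no; exists k.
    by rewrite leqNgt Ku.
  have kN x : x \in N -> c1 x != k.
    move=> /NK[y yK ->]; apply: contraNneq kK => <-.
    by apply: map_f; rewrite mem_enum.
  have adjN x : x \in U -> adj u x -> x \in N.
    move=> xU; rewrite /adjacent /= (negPf (src x xU)) orbF => ux.
    by apply/NP.
  exists (fun x => if x == u then k else c1 x); split=> [x xU|x y xU yU].
    by case: eqVneq => // xu; apply: cm; rewrite !inE xu.
  have [->|xu] := eqVneq x u; have [->|yu] := eqVneq y u.
  - by rewrite adjxx.
  - by move/(adjN y yU)/kN; rewrite eq_sym.
  - by rewrite adj_sym => /(adjN x xU)/kN.
  - by apply: cP; rewrite !inE ?xu ?yu.
pose W := [set w in N | [forall x in N, near w x]].
have WN : W \subset N by apply/subsetP => x; rewrite inE => /andP[].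
have Wnear w x : w \in W -> x \in N -> near w x.
  by rewrite inE => /andP[_ /forall_inP H] /H.
have cW : clique adj W.
  by move=> x y xW yW; apply: near_adj; apply: Wnear => //; apply: (subsetP WN).
have [Q0|[q0]] := set_0Vmem (N :\: W).
  apply: (finish c W) => // x xN; exists x => //; apply: contraT => xW.
  by have := in_set0 x; rewrite -Q0 inE xN xW.
set Q := N :\: W => q0Q.
have QN q : q \in Q -> q \in N by rewrite inE => /andP[].
have iQ : independent adj Q.
  (* Such an arc would make [q'] near every out-neighbour of [u], hence a member of [W]. *)
  have noarc q q' : q \in Q -> q' \in Q -> ~~ e q q'.
    move=> qQ q'Q; apply/negP => qq'.
    move: q'Q; rewrite inE => /andP[/negP nW q'N]; apply: nW.
    rewrite inE q'N; apply/forall_inP => x /NP[_ ux].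
    have /NP[_ uq] := QN q qQ.
    by rewrite near_sym; apply: out_near uq ux qq'.
  by move=> q q' qQ q'Q; rewrite /adjacent /= negb_or !noarc.
have QU q : q \in Q -> q \in U :\ u.
  move/QN/NP => [qU uq]; rewrite !inE qU andbT.
  by apply: contraTneq uq => ->; rewrite eirr.
have NQ x : x \in N -> x \notin W -> x \in Q by move=> xN xW; rewrite inE xW.
clearbody Q.
(* Swapping the two colours on the Kempe component of [q] gives [q] the colour of [q0]. By
   [no_kempe_chain] that component contains no vertex of [Q] already having this colour, so the
   number of exceptions decreases. *)
have [c1 [col1 mono]] : exists c1, colouring adj (U :\ u) m c1 /\
    {in Q, forall q, c1 q = c1 q0}.
  have [k] := ubnP #|[set q in Q | c q != c q0]|.
  elim: k => // k IH in c col *; rewrite ltnS => ck.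
  have [E|[q]] := set_0Vmem [set q in Q | c q != c q0].
    exists c; split=> // q qQ; apply/eqP; apply: contraT => qq0.
    by have := in_set0 q; rewrite -E inE qQ qq0.
  rewrite inE => /andP[qQ qq0]; have [cm cP] := col.
  pose two x := (c x == c q0) || (c x == c q).
  pose r := [rel x y | [&& x \in U :\ u, y \in U :\ u, adj x y, two x & two y]].
  pose K := [set x | connect r q x].
  have KU x : x \in K -> (x \in U :\ u) && two x.
    rewrite inE => qx.
    apply: (@connect_preserved r (fun x => (x \in U :\ u) && two x) q) qx.
      by rewrite QU // /two eqxx orbT.
    by move=> a b _ /and5P[_ -> _ _ ->].
  have Kq q' : q' \in Q -> q' \in K -> c q' != c q0.
    move=> q'Q; rewrite inE => /connectP[s rs E].
    pose p i := nth q (q :: s) i.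
    have rp i : i < size s -> r (p i) (p i.+1).
      by move=> si; apply: (pathP q rs).
    have pU i : i <= size s -> (p i \in U :\ u) && two (p i).
      case: i => [_|i /rp/and5P[_ -> _ _ ->] //].
      by rewrite /p /= QU // /two eqxx orbT.
    have pc i : i <= size s -> c (p i) = if odd i then c q0 else c q.
      elim: i => [//|i IHi] si; have /and5P[piU piU' ad _ t] := rp i si.
      have := cP _ _ piU piU' ad; rewrite IHi ?(ltnW si) //=.
      move: t; rewrite /two; case: (odd i) => /= /orP[] /eqP -> //;
      by rewrite eqxx.
    have pl : p (size s) = q' by rewrite E /p -[size s]/(size (q :: s)).-1 nth_last.
    apply/eqP => cq'.
    have ol : odd (size s).
      by have := pc _ (leqnn _); rewrite pl cq'; case: odd => // E2;
        rewrite E2 eqxx in qq0.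
    have /NP[_ uq] := QN q qQ; have /NP[_ uq'] := QN q' q'Q.
    apply: (@no_kempe_chain c (c q) (c q0) u (size s) p) => //.
    - move=> i j il jl; apply: cP.
        by case/andP: (pU i il).
      by case/andP: (pU j jl).
    - by move=> i /rp/and5P[].
    - by rewrite pl.
    - by rewrite pl; apply: iQ.
  pose c1 x := if x \in K then if c x == c q0 then c q else c q0 else c x.
  have q0K : q0 \notin K by apply/negP => /(Kq q0 q0Q); rewrite eqxx.
  apply: (IH c1).
    split=> [x xU|x y xU yU].
      rewrite /c1; case: ifP => _; last exact: cm.
      by case: ifP => _; apply: cm; apply: QU.
    have mixed a b : a \in U :\ u -> b \in U :\ u -> a \in K -> b \notin K ->
        adj a b -> (if c a == c q0 then c q else c q0) != c b.
      move=> aU bU' aK bK ad; have /andP[_ ta] := KU a aK.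
      have : ~~ two b.
        apply: contra bK => tb; rewrite !inE in aK *; apply: connect_trans aK _.
        by apply: connect1; rewrite /= aU bU' ad ta tb.
      by rewrite /two negb_or; case: ifP => _ /andP[];
        rewrite eq_sym => // ?; rewrite eq_sym.
    move=> ad; have := cP x y xU yU ad; rewrite /c1.
    have [xK|xK] := boolP (x \in K); have [yK|yK] := boolP (y \in K).
    - have /andP[_ /orP[]/eqP Ex] := KU x xK;
      have /andP[_ /orP[]/eqP Ey] := KU y yK;
      by rewrite Ex Ey ?eqxx ?(negPf qq0) //= => _; rewrite // eq_sym.
    - by move=> _; apply: mixed.
    - by move=> _; rewrite eq_sym; apply: mixed; rewrite // adj_sym.
    - by [].
  rewrite [c1 q0]/c1 (negPf q0K); apply: leq_trans ck.
  apply: proper_card; apply/properP; split.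
    apply/subsetP => x; rewrite !inE /c1; case/andP => xQ; case: ifP => xK.
      by rewrite xQ /= => _; apply: Kq.
    by rewrite xQ.
  exists q; first by rewrite inE qQ.
  have qK : q \in K by rewrite inE connect0.
  by rewrite !inE qQ /c1 qK (negPf qq0) eqxx.
apply: (finish c1 (q0 |: W)) => //.
- by rewrite subUset sub1set QN.
- have nq w : w \in W -> near w q0 by move=> wW; apply: Wnear (QN q0 q0Q).
  move=> x y /setU1P[->|xW] /setU1P[->|yW]; rewrite ?eqxx //; last exact: cW.
    by rewrite eq_sym adj_sym; apply: near_adj; apply: nq.
  by apply: near_adj; apply: nq.
move=> x xN; have [xW|xW] := boolP (x \in W).
  by exists x => //; apply: setU1r.
by exists q0; rewrite ?setU11 // mono // NQ.
Qed.

(** * Initial strong components and their exits *)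

Definition arc_in (U : {set T}) := [rel x y | [&& x \in U, y \in U & e x y]].

Definition strong (U : {set T}) : Prop :=
  {in U &, forall x y, connect (arc_in U) x y}.

(** When this fails, [colouring_dominated] reduces the colouring of [U] to a smaller set. *)
Definition undominated (U : {set T}) : Prop :=
  {in U &, forall x y, x != y -> ~~ adj x y ->
    ~ {in U, forall z, adj z x -> adj z y}}.

(** The ancestors of a vertex [x] with fewest ancestors all have the same ancestors as [x]. *)
Lemma initial_component (U : {set T}) : U != set0 ->
  exists C : {set T}, [/\ C \subset U, C != set0, strong C
    & forall x c, x \in U -> c \in C -> e x c -> x \in C].
Proof.
case/set0Pn => x0 x0U; pose anc x := [set y | connect (arc_in U) y x].
have [x xU xmin] : exists2 x, x \in U & forall y, y \in U -> #|anc x| <= #|anc y|.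
  by case: (arg_minnP (fun x => #|anc x|) x0U) => x; exists x.
have ancU y z : z \in U -> y \in anc z -> y \in U.
  move=> zU; rewrite inE => /connectP[[|a s] /=]; first by move=> _ <-.
  by case/andP => /andP[].
have back y : y \in anc x -> x \in anc y.
  move=> yx; have yU := ancU y x xU yx.
  have /eqP -> : anc y == anc x.
    rewrite eqEcard xmin // andbT; apply/subsetP => z; rewrite !inE => zy.
    by apply: connect_trans zy _; rewrite inE in yx.
  by rewrite inE connect0.
have inC a b : a \in U -> b \in anc x -> e a b -> a \in anc x.
  move=> aU bx ab; have bU := ancU b x xU bx; rewrite !inE in bx *.
  by apply: connect_trans bx; apply: connect1; rewrite /= aU bU.
exists (anc x); split=> //.
- by apply/subsetP => y; apply: ancU.
- by apply/set0Pn; exists x; rewrite inE connect0.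
move=> y z yx zx; have : connect (arc_in U) y z.
  move: (back z zx) (yx); rewrite !inE => xz /connect_trans; exact.
case/connectP => s ps E; apply/connectP; exists s => //.
elim: s y yx ps E => //= a s IH y yx /andP[/and3P[yU aU ya] ps] E.
suff ax : a \in anc x by rewrite yx ax ya IH.
elim: s a aU ps E {IH ya} => /= [a _ _ <- //|b s IHs a aU /andP[/and3P[_ bU ab] ps] E].
by apply: inC ab => //; apply: IHs.
Qed.

Lemma component_has_out (U C : {set T}) c :
  {in U, forall v, exists2 u, u \in U & e u v} -> C \subset U -> strong C ->
  (forall x c, x \in U -> c \in C -> e x c -> x \in C) -> c \in C ->
  exists2 d, d \in C & e c d.
Proof.
move=> nosrc CU sC inC cC; have [u uU uc] := nosrc c (subsetP CU c cC).
have uC := inC u c uU cC uc.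
have /connectP[[|d s] /=] := sC c u cC uC.
  by move=> _ E; rewrite E eirr in uc.
by case/andP => /and3P[_ dC cd] _ _; exists d.
Qed.

(** Every vertex of [C] has an arc to [v] or an in-neighbour with one, because arcs of [C] lead from
    the second kind to the first. If [d] had no arc to [v], all its neighbours would be adjacent to
    [v], against [undominated]. *)
Lemma component_dominates_exits (U C : {set T}) c v :
  {in U, forall v, exists2 u, u \in U & e u v} -> undominated U ->
  C \subset U -> strong C ->
  (forall x c, x \in U -> c \in C -> e x c -> x \in C) ->
  c \in C -> v \in U -> v \notin C -> e c v -> {in C, forall d, e d v}.
Proof.
move=> nosrc und CU sC inC cC vU vC cv d dC; apply: contraT => ndv; exfalso.
have noback x : x \in C -> ~~ e v x.
  by move=> xC; apply: contra vC; apply: inC.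
have sub x : x \in C -> x \in U by apply: (subsetP CU).
pose inA x := (x \in C) && e x v.
pose inB x := exists2 a, inA a & e a x.
have stepA x y : inA x -> e x y -> inB y by move=> xA xy; exists x.
have stepB x y : inB x -> e x y -> y \in C -> inA y.
  move=> [a /andP[aC av] ax] xy yC.
  have yv : y != v by apply: contraNneq vC => <-.
  have := near_adj (out_near ax av xy); rewrite eq_sym => /(_ yv).
  by rewrite /inA yC /adjacent /= (negPf (noback y yC)).
have AB x : x \in C -> inA x \/ inB x.
  move=> xC; apply: (@connect_preserved (arc_in C) (fun x => inA x \/ inB x) c).
  - by left; rewrite /inA cC.
  - move=> a b [aA|aB] /and3P[_ bC ab]; first by right; apply: stepA ab.
    by left; apply: stepB ab bC.
  - exact: sC.
have dB : inB d by case: (AB d dC) => //; rewrite /inA dC (negPf ndv).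
have dv : d != v by apply: contraNneq vC => <-.
apply: (und d v (sub d dC) vU dv).
  by rewrite /adjacent /= negb_or ndv noback.
move=> z zU /orP[zd|dz].
  have zC := inC z d zU dC zd; case: (AB z zC) => [/andP[_ /arc_adj]|zB] //.
  by have := stepB z d zB zd dC; rewrite /inA (negPf ndv) andbF.
have [zC|zC] := boolP (z \in C).
  by have /andP[_ /arc_adj] := stepB d z dB dz zC.
have [a /andP[aC av] ad] := dB.
apply: near_adj; first by rewrite near_sym; apply: out_near ad av dz.
by apply: contraNneq ndv => <-.
Qed.

(** * Strong digraphs without dominated vertices *)

Section Strong.
Variable U : {set T}.
Hypotheses (sU : strong U) (undU : undominated U).

(** Along a walk from [x] to [v], each arc turns one alternative into the next, rotating the
    triangle. Whenever the walk meets the triangle, the alternative is started afresh by [J0]. *)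
Lemma cyclic_triangle_near x y z v :
  x \in U -> e x y -> e y z -> e z x -> v \in U ->
  [\/ (forall w, e x w -> near w v) /\ near z v,
      (forall w, e y w -> near w v) /\ near x v
    | (forall w, e z w -> near w v) /\ near y v].
Proof.
move=> xU xy yz zx vU.
pose J p q v := (forall w, e p w -> near w v) /\ near q v.
have J0 p q : e q p -> J p q p.
  move=> qp; split=> [w pw|]; apply: adj_near; first exact: arc_adjC.
  exact: arc_adj.
have step a b c u u' : e a b -> e b c -> e c a -> J a c u -> u != b -> u != c ->
    e u u' -> J b a u'.
  move=> ab bc ca [Ju1 Ju2] ub uc uu'; split=> [w bw|].
    have bu : adj b u by apply: near_adj; rewrite ?Ju1 // eq_sym.
    exact: adj_out_near bu bw uu'.
  have cu : adj c u by apply: near_adj; rewrite // eq_sym.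
  exact: adj_out_near cu ca uu'.
apply: (@connect_preserved (arc_in U) (fun v => [\/ J x z v, J y x v | J z y v]) x v);
  last exact: sU; first by constructor 1; apply: J0.
move=> a b Ja /and3P[_ _ ab].
have [[xy' yz'] zx'] := (arc_neq xy, arc_neq yz, arc_neq zx).
have [E|ax] := eqVneq a x.
  by constructor 2; rewrite E in ab; apply: (step x y z x b) => //;
    [exact: J0|rewrite eq_sym].
have [E|ay] := eqVneq a y.
  by constructor 3; rewrite E in ab; apply: (step y z x y b) => //;
    [exact: J0|rewrite eq_sym].
have [E|az] := eqVneq a z.
  by constructor 1; rewrite E in ab; apply: (step z x y z b) => //;
    [exact: J0|rewrite eq_sym].
case: Ja => Ja.
- by constructor 2; apply: (step x y z a b).
- by constructor 3; apply: (step y z x a b).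
- by constructor 1; apply: (step z x y a b).
Qed.

(** Otherwise every neighbour [t] of [y] is adjacent to [w], against [undU]. In the critical case
    [t] has an arc to [y]; then [t] is not near [x], and [cyclic_triangle_near] leaves only the
    alternative that makes [w] near [t]. *)
Lemma cyclic_triangle_out x y z w :
  x \in U -> y \in U -> z \in U -> w \in U ->
  e x y -> e y z -> e z x -> e x w -> near y w.
Proof.
move=> xU yU zU wU xy yz zx xw; apply: contraT => nyw; exfalso.
have [yw ayw] : y != w /\ ~~ adj y w by apply/andP; rewrite -negb_or.
apply: (undU yU wU yw ayw) => t tU tadj.
have tw : t != w by apply: contraNneq ayw => <-; rewrite adj_sym.
case/orP: tadj => [ty|yt]; last first.
  by apply: near_adj; rewrite // near_sym; apply: out_near xy xw yt.
have [xt|xt] := eqVneq x t; first by rewrite -xt arc_adj.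
have nxt : ~~ near x t.
  apply/negP => /near_cases[E|x_t|tx]; first by rewrite E eqxx in xt.
  - by move: nyw; rewrite near_sym (out_near x_t xw ty).
  - by move: nyw; rewrite (out_near tx ty xw).
case: (cyclic_triangle_near xU xy yz zx tU) => -[H1 H2].
- by apply: near_adj tw; rewrite near_sym H1.
- by rewrite H2 in nxt.
- by rewrite H1 in nxt.
Qed.

(** Of a transitive triangle only the vertex with two in-neighbours counts; in this form the
    property passes along arcs. *)
Definition on_triangle y : Prop :=
  (exists x x', [/\ x \in U, x' \in U, e x x', e x y & e x' y]) \/
  (exists z x, [/\ z \in U, x \in U, e y z, e z x & e x y]).

Lemma on_triangle_step y z :
  y \in U -> z \in U -> e y z -> on_triangle y -> on_triangle z.
Proof.
move=> yU zU yz [[x [x' [xU x'U xx' xy x'y]]]|[z' [x [z'U xU yz' z'x xy]]]].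
  case: (near_cases (out_near xy xx' yz)) => [E|x'z|zx'].
  - by left; exists x, y; split=> //; rewrite -E.
  - by left; exists x', y.
  - by right; exists x', y.
case: (near_cases (out_near yz' yz z'x)) => [->|zx|xz].
- by right; exists y, z'.
- by right; exists x, y.
- by left; exists x, y.
Qed.

Lemma on_triangle_out_near y c d :
  y \in U -> c \in U -> d \in U -> on_triangle y -> e y c -> e y d -> near c d.
Proof.
move=> yU cU dU [[x [x' [xU x'U xx' xy x'y]]]|[z [x [zU xU yz zx xy]]]] yc yd.
  case: (near_cases (out_near xy xx' yc)) => [E|x'c|cx'].
  - by rewrite -E; apply: out_near xy xx' yd.
  - by apply: out_near x'y x'c yd.
  - exact: (cyclic_triangle_out yU cU x'U dU yc cx' x'y yd).
have zc := cyclic_triangle_out yU zU xU cU yz zx xy yc.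
case: (near_cases (out_near yz yc zx)) => [E|cx|xc].
- by rewrite E near_sym; apply: out_near yz yd zx.
- exact: (cyclic_triangle_out yU cU xU dU yc cx xy yd).
- exact: out_near xy xc yd.
Qed.

Lemma on_triangle_all x y : x \in U -> on_triangle x -> y \in U -> on_triangle y.
Proof.
move=> xU tx yU; apply: (@connect_preserved (arc_in U) on_triangle x y) => //.
  by move=> a b ta /and3P[aU bU ab]; apply: on_triangle_step ab ta.
exact: sU.
Qed.

Lemma adjacent_triple_on_triangle x y z :
  x \in U -> y \in U -> z \in U -> adj x y -> adj y z -> adj x z ->
  exists2 w, w \in U & on_triangle w.
Proof.
move=> xU yU zU.
case/orP => [xy|yx]; case/orP => [yz|zy]; case/orP => [xz|zx].
- by exists z => //; left; exists x, y.
- by exists z => //; right; exists x, y.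
- by exists y => //; left; exists x, z.
- by exists y => //; left; exists z, x; split.
- by exists z => //; left; exists y, x.
- by exists x => //; left; exists y, z.
- by exists x => //; right; exists z, y.
- by exists x => //; left; exists z, y.
Qed.

Definition walk k p q :=
  exists s, [/\ path (arc_in U) p s, size s = k & last p s = q].

Lemma walk_cat j k p q r : walk j p q -> walk k q r -> walk (j + k) p r.
Proof.
move=> [s [ps <- <-]] [s' [ps' <- <-]]; exists (s ++ s').
by rewrite cat_path ps ps' size_cat last_cat.
Qed.

Lemma walk_loop j k p : walk j p p -> walk (k * j) p p.
Proof.
move=> w; elim: k => [|k IH]; first by exists [::].
by rewrite mulSn; apply: walk_cat IH.
Qed.

Lemma walk1 p q : p \in U -> q \in U -> e p q -> walk 1 p q.
Proof. by move=> pU qU pq; exists [:: q]; rewrite /= pU qU pq. Qed.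

(** The two walks advance in parallel. Where they coincide, [on_triangle_out_near] takes the place
    of the local condition. *)
Lemma near_walk k p p' q q' :
  {in U, forall x, on_triangle x} -> p \in U -> near p q ->
  walk k p p' -> walk k q q' -> near p' q'.
Proof.
move=> tri; elim: k p q => [|k IH] p q pU npq.
  by move=> [[|a s] [_ // _ <-]] [[|b s'] [_ // _ <-]].
move=> [[|a s] [//= /andP[/and3P[_ aU pa] ps] [ss] ls]].
move=> [[|b s'] [//= /andP[/and3P[qU bU qb] ps'] [ss'] ls']].
apply: (IH a b aU); [|by exists s|by exists s'].
have [E|pq] := eqVneq p q; last exact: adj_out_near (near_adj npq pq) pa qb.
by apply: (on_triangle_out_near pU aU bU (tri p pU) pa); rewrite E.
Qed.

(* If y is the head of x -> x' -> y and of x -> y, it lies on closed walks of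
   consecutive lengths L and L + 1, so that any vertex is reached from y by a
   walk as long as some closed walk at y. *)
Lemma on_triangle_universal y : {in U, forall x, on_triangle x} -> y \in U ->
  exists2 y', y' \in U & {in U, forall v, near y' v}.
Proof.
move=> tri yU.
case: (tri y yU) => [[x [x' [xU x'U xx' xy x'y]]]|[z [x [zU xU yz zx xy]]]].
  exists y => // v vU.
  have /connectP[s ps ls] := sU yU vU.
  have /connectP[t pt lt] := sU yU xU.
  pose L := (size t + 1).
  have w1 : walk L y y.
    by apply: walk_cat (walk1 xU yU xy); exists t.
  have w2 : walk (L + 1) y y.
    rewrite /L -addnA; apply: (@walk_cat _ _ _ x); first by exists t.
    exact: walk_cat (walk1 xU x'U xx') (walk1 x'U yU x'y).
  apply: (@near_walk (size s * (L + 1)) y y y v tri yU (near_refl y)).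
    exact: walk_loop.
  rewrite mulnDr muln1; apply: walk_cat (walk_loop (size s) w1) _.
  by exists s.
(* On a cyclic triangle, being near all three vertices is preserved along every arc. *)
exists y => // v vU.
suff [] : [/\ near x v, near y v & near z v] by [].
apply: (@connect_preserved (arc_in U)
  (fun v => [/\ near x v, near y v & near z v]) y v); last exact: sU.
  by rewrite near_refl; split=> //; apply: adj_near; [apply: arc_adj|apply: arc_adjC].
move=> a b [xa ya za] /and3P[aU bU ab].
have step p q : p \in U -> q \in U -> near p a -> e p q -> near q b.
  move=> pU qU pa pq.
  have [E|np] := eqVneq p a; last exact: adj_out_near (near_adj pa np) pq ab.
  by apply: (on_triangle_out_near pU qU bU (tri p pU) pq); rewrite E.
by split; [apply: step za zx|apply: step xa xy|apply: step ya yz].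
Qed.

(** In the double cover by parity, a path from [(r, false)] to [(r, true)] is an odd closed walk.
    Without one, the parity of the walks from [r] is a proper 2-colouring. *)
Lemma strong_triangle_free_bipartite :
  triangle_free U -> ~ induced_odd_dicycle U ->
  exists c : T -> bool, {in U &, forall x y, adj x y -> c x != c y}.
Proof.
move=> tf noU; have [->|[r rU]] := set_0Vmem U.
  by exists (fun=> true) => x; rewrite inE.
pose st := [rel p q : T * bool | arc_in U p.1 q.1 && (q.2 == ~~ p.2)].
have stP x y b : x \in U -> y \in U -> e x y -> st (x, b) (y, ~~ b).
  by move=> xU yU xy; rewrite /= xU yU xy eqxx.
have odd_walk : ~~ connect st (r, false) (r, true).
  apply/negP => /connectP[s ps ls]; apply: noU.
  pose p i := nth (r, false) ((r, false) :: s) i.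
  have pS i : i < size s -> st (p i) (p i.+1) by move=> si; apply: (pathP _ ps).
  have pn : p (size s) = (r, true).
    by rewrite ls /p -[size s]/(size ((r, false) :: s)).-1 nth_last.
  have par i : i <= size s -> (p i).2 = odd i.
    elim: i => [//|i IH] si; have /andP[_ /eqP ->] := pS i si.
    by rewrite IH // ltnW.
  have on : odd (size s) by rewrite -(par _ (leqnn _)) pn.
  have n0 : 0 < size s by case: (size s) on.
  have stm k : e (p (k %% size s)).1 (p (k.+1 %% size s)).1.
    have lt := ltn_pmod k n0; have /andP[/and3P[_ _ E] _] := pS _ lt.
    suff -> : (p (k.+1 %% size s)).1 = (p (k %% size s).+1).1 by [].
    rewrite -(addn1 k) -modnDml addn1; have [->|ne] := eqVneq (k %% size s).+1 (size s).
      by rewrite modnn pn.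
    by rewrite modn_small // ltn_neqAle ne.
  apply: (@odd_closed_walk_induced U (size s) (fun k => (p (k %% size s)).1)) => //.
    by move=> k; have lt := ltn_pmod k n0; have /andP[/and3P[]] := pS _ lt.
  by move=> k; rewrite modnDr.
have flip p q : connect st p q -> connect st (p.1, ~~ p.2) (q.1, ~~ q.2).
  case/connectP => s; elim: s p => [|a s IH] p /=; first by move=> _ ->.
  case/andP => /andP[pa /eqP a2] ps E; apply: connect_trans (IH a ps E).
  by apply: connect1; rewrite /= pa a2 eqxx.
have lift x y b : connect (arc_in U) x y -> exists b', connect st (x, b) (y, b').
  case/connectP => s; elim: s x b => [|a s IH] x b /=.
    by move=> _ ->; exists b.
  case/andP => xa ps E; have [b' cb] := IH a (~~ b) ps E.
  exists b'; apply: connect_trans cb; apply: connect1.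
  by rewrite /= xa eqxx.
have unique x : x \in U ->
    connect st (r, false) (x, true) -> ~~ connect st (r, false) (x, false).
  move=> xU ct; apply: contra odd_walk => cf.
  have [[] cb] := lift x r true (sU xU rU).
    exact: connect_trans ct cb.
  exact: connect_trans cf (flip _ _ cb).
pose c x := connect st (r, false) (x, true).
have arc x y : x \in U -> y \in U -> e x y -> c x != c y.
  move=> xU yU xy; rewrite /c.
  have [cx|ncx] := boolP (connect st (r, false) (x, true)).
    have cy : connect st (r, false) (y, false).
      by apply: connect_trans cx _; apply: connect1; apply: (stP x y true).
    by have [/(unique y yU)|] := boolP (connect st _ (y, true)); rewrite ?cy.
  have [[] cx] := lift r x false (sU rU xU); first by rewrite cx in ncx.
  have cy : connect st (r, false) (y, true).
    by apply: connect_trans cx _; apply: connect1; apply: (stP x y false).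
  by rewrite cy.
exists c => x y xU yU /orP[|yx]; first exact: arc.
by rewrite eq_sym arc.
Qed.

End Strong.

(** Induction on [#|U|]. A dominated vertex or a source is removed and coloured last. Otherwise an
    initial strong component [C] is either proper, and joined to the clique [E] of its exits, or all
    of [U], which is then bipartite or has a universal vertex. *)
Lemma no_induced_odd_dicycle_colouring (U : {set T}) m :
  ~ induced_odd_dicycle U -> cliques_bounded adj U m ->
  exists c, colouring adj U m c.
Proof.
have [N] := ubnP #|U|; elim: N => // N IH in U m *; rewrite ltnS => UN noU bU.
have IHp (A : {set T}) m' : A \proper U -> cliques_bounded adj A m' ->
    exists c, colouring adj A m' c.
  move=> AU bA; apply: IH bA; first exact: leq_trans (proper_card AU) UN.
  by move=> noA; apply: noU; apply: induced_odd_dicycleS noA; apply: proper_sub.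
have IHD (A : {set T}) : A != set0 -> A \subset U ->
    exists c, colouring adj (U :\: A) m c.
  case/set0Pn => a aA AU; apply: IHp; last exact: cliques_boundedS (subsetDl _ _) bU.
  apply/properP; split; first exact: subsetDl.
  by exists a; [apply: (subsetP AU)|rewrite inE aA].
have [U0|Un0] := eqVneq U set0.
  by exists (fun=> 0); split=> x; rewrite U0 inE.
have [undU|] := classic (undominated U); last first.
  move=> ndom; apply: NNPP => nocol; apply: ndom => x y xU yU xy nxy dom.
  have [| |c col] := IHD [set x].
  - by apply/set0Pn; exists x; rewrite inE.
  - by rewrite sub1set.
  by apply: nocol; apply: (colouring_dominated adjxx adj_sym xU yU xy nxy dom col).
have [[u uU src]|nosrc] := classic (exists2 u, u \in U & {in U, forall v, ~~ e v u}).
  have [| |c col] := IHD [set u].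
  - by apply/set0Pn; exists u; rewrite inE.
  - by rewrite sub1set.
  exact: colouring_source uU src bU col.
have {}nosrc : {in U, forall v, exists2 u, u \in U & e u v}.
  move=> v vU; apply: NNPP => no; apply: nosrc; exists v => // u uU.
  by apply/negP => uv; apply: no; exists u.
have [C [CU Cn0 sC inC]] := initial_component Un0.
have [CeU|CnU] := eqVneq C U.
  have sU : strong U by rewrite -CeU.
  have [tf|ntf] := classic (triangle_free U).
    have [c cP] := strong_triangle_free_bipartite sU tf noU.
    exists (fun x => c x : nat); split=> [x xU|x y xU yU /(cP x y xU yU)].
      have [u uU ux] := nosrc x xU.
      suff : 2 <= m by case: (c x) => /=; lia.
      have <- : #|[set u; x]| = 2 by rewrite cards2 (arc_neq ux).
      apply: bU; first by rewrite subUset !sub1set uU xU.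
      move=> a b; rewrite !inE => /orP[]/eqP-> /orP[]/eqP->; rewrite ?eqxx //.
        by rewrite arc_adj.
      by rewrite arc_adjC.
    by case: (c x); case: (c y).
  have [w wU tw] : exists2 w, w \in U & on_triangle U w.
    apply: NNPP => no; apply: ntf => x y z xU yU zU; apply/negP => /and3P[xy yz xz].
    exact: no (adjacent_triple_on_triangle xU yU zU xy yz xz).
  have tri : {in U, forall x, on_triangle U x}.
    by move=> x xU; apply: on_triangle_all wU tw xU.
  have [y yU univ] := on_triangle_universal sU undU tri wU.
  have UDy : U :\: (U :\ y) = [set y].
    apply/setP => x; rewrite !inE; case: (eqVneq x y) => [->|] //=.
    by case: (x \in U).
  have yUy : U :\ y \proper U by apply: properD1.
  have uy x : x \in U :\ y -> adj x y.
    rewrite !inE => /andP[xy xU]; rewrite adj_sym.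
    by apply: near_adj; [apply: univ|rewrite eq_sym].
  have [U1|U1] := eqVneq (U :\ y) set0.
    have m0 : 0 < m.
      rewrite -(cards1 y); apply: bU; first by rewrite sub1set.
      by move=> a b; rewrite !inE => /eqP -> /eqP ->; rewrite eqxx.
    have Uy x : x \in U -> x = y.
      move=> xU; apply/eqP; apply: contraT => xy.
      by have := in_set0 x; rewrite -U1 !inE xy xU.
    exists (fun=> 0); split=> // a b /Uy -> /Uy ->.
    by rewrite adjxx.
  have [c col] := IHD (U :\ y) U1 (subsetDl _ _).
  apply: (@colouring_join _ adj adj_sym U (U :\ y) [set y] m c) => //.
  - exact: subsetDl.
  - by rewrite UDy.
  - by move=> a b; rewrite !inE => /eqP -> /eqP ->; rewrite eqxx.
  - by move=> a b /uy ab; rewrite inE => /eqP ->.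
  - by move=> a b _; rewrite UDy.
  - by move=> m'; apply: IHp.
have CpU : C \proper U by rewrite properEneq CnU.
pose E := [set v in U :\: C | [exists c in C, e c v]].
have dom v c : v \in E -> c \in C -> e c v.
  rewrite inE => /andP[]; rewrite inE => /andP[vC vU] /exists_inP[d dC dv] cC.
  exact: (component_dominates_exits nosrc undU CU sC inC dC vU vC dv).
have [c col] := IHD C Cn0 CU.
apply: (@colouring_join _ adj adj_sym U C E m c) => //.
- by apply/subsetP => v; rewrite inE => /andP[].
- move=> v w vE wE vw; apply: near_adj vw.
  have [a aC] := set0Pn _ Cn0.
  have [b bC ab] := component_has_out nosrc CU sC inC aC.
  exact: out_near ab (dom v a vE aC) (dom w b wE bC).
- by move=> a v aC vE; rewrite arc_adj ?dom.
- move=> a v aC vUC /orP[av|va].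
    by rewrite inE vUC; apply/exists_inP; exists a.
  move: vUC; rewrite inE => /andP[/negP vC vU].
  by case: vC; apply: inC va.
- by move=> m'; apply: IHp.
Qed.

(** * Path partitions *)

Definition traceable (X : {set T}) : Prop :=
  exists q, [/\ uniq q, sorted e q & q =i X].

(* The vertex of S on the path of v is f v. *)
Definition S_paths (U S : {set T}) (f : T -> T) : Prop :=
  [/\ {in U, forall v, f v \in S}, {in S, forall s, f s = s}
    & {in S, forall s, traceable [set v in U | f v == s]}].

(** [x] goes before the first vertex of [q] to which it has an arc, or at the end. *)
Lemma path_insert_adjacent x y q :
  path e y q -> e y x -> {in q, forall z, adj x z} ->
  exists2 q', perm_eq q' (x :: q) & path e y q'.
Proof.
elim: q y => [|z q IH] y /=; first by exists [:: x]; rewrite //= andbT.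
case/andP => yz pq yx xq; have /orP[xz|zx] := xq z (mem_head _ _).
  by exists [:: x, z & q]; rewrite //= yx xz.
have [|q' pq' pzq'] := IH z pq zx.
  by move=> w wq; apply: xq; rewrite inE wq orbT.
exists (z :: q'); last by rewrite /= yz.
apply: (@perm_trans _ [:: z, x & q]); first by rewrite perm_cons.
by rewrite -[x :: q]cat1s -[z :: q]cat1s -cat1s perm_catCA.
Qed.

(** Redei's theorem for semicomplete digraphs, by inserting the vertices one at a time. *)
Lemma clique_traceable X : clique adj X -> traceable X.
Proof.
move=> cX; suff [q pq sq] : exists2 q, perm_eq q (enum X) & sorted e q.
  exists q; split=> // [|x]; first by rewrite (perm_uniq pq) enum_uniq.
  by rewrite (perm_mem pq) mem_enum.
have : uniq (enum X) by apply: enum_uniq.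
have : {subset enum X <= X} by move=> x; rewrite mem_enum.
elim: (enum X) => [|x s IH] sX; first by exists [::].
case/andP => xs us; have [|[|y q] pq sq] := IH _ us.
- by move=> z zs; apply: sX; rewrite inE zs orbT.
- exists [:: x] => //.
  by move/perm_size: pq; case: (s).
have yq : {in y :: q, forall z, adj x z}.
  move=> z; rewrite (perm_mem pq) => zs; apply: cX; [exact/sX/mem_head| |].
    by apply: sX; rewrite inE zs orbT.
  by apply: contraNneq xs => ->.
have /orP[xy|yx] := yq y (mem_head _ _).
  by exists [:: x, y & q]; rewrite ?perm_cons //= xy.
have [|q' pq' sq'] := @path_insert_adjacent x y q sq yx.
  by move=> z zq; apply: yq; rewrite inE zq orbT.
exists (y :: q') => //.
apply: (@perm_trans _ [:: y, x & q]); first by rewrite perm_cons.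
apply: (@perm_trans _ [:: x, y & q]); last by rewrite perm_cons.
by rewrite -[x :: q]cat1s -[y :: q]cat1s -cat1s perm_catCA.
Qed.

(* The property of w with respect to v passes on to the successor of v on the
   path as long as w does not fit between the two. *)
Lemma path_insert_out v w q :
  path e v q -> e v w -> w \notin q ->
  {in q, forall x, e v x -> near x w} ->
  exists2 q', perm_eq q' (w :: q) & path e v q'.
Proof.
elim: q v => [|z q IH] v /=; first by exists [:: w]; rewrite //= andbT.
case/andP => vz pq vw; rewrite inE negb_or => /andP[wz wq] vq.
case: (near_cases (vq z (mem_head _ _) vz)) => [E|zw|wz'].
- by rewrite E eqxx in wz.
- have [|q' pq' pzq'] := IH z pq zw wq.
    by move=> x _ zx; rewrite near_sym; apply: out_near vz vw zx.
  exists (z :: q'); last by rewrite /= vz.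
  apply: (@perm_trans _ [:: z, w & q]); first by rewrite perm_cons.
  by rewrite -[w :: q]cat1s -[z :: q]cat1s -cat1s perm_catCA.
- by exists [:: w, z & q]; rewrite //= vw wz'.
Qed.

Lemma maximum_independentD (U S B : {set T}) :
  maximum_independent adj U S -> [disjoint B & S] ->
  maximum_independent adj (U :\: B) S.
Proof.
move=> [SU iS mS] BS; split=> //.
  by rewrite subsetD SU disjoint_sym.
by move=> S' /subset_trans/(_ (subsetDl U B)); apply: mS.
Qed.

(** By [path_insert_out], [w] fits into the path of [v] somewhere after [v]. *)
Lemma S_paths_insert (U S : {set T}) v w f :
  v \in U -> w \in U -> w \notin S -> e v w ->
  {in U, forall x, e v x -> near x w} ->
  S_paths (U :\ w) S f -> exists f', S_paths U S f'.
Proof.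
move=> vU wU wS vw near_w [f1 f2 f3].
have vUw : v \in U :\ w by rewrite !inE (arc_neq vw).
exists (fun x => if x == w then f v else f x); split.
- move=> x xU; case: eqVneq => xw; first exact: f1.
  by apply: f1; rewrite !inE xw.
- by move=> s sS; rewrite ifN ?f2 //; apply: contraNneq wS => <-.
move=> s sS; have [q [uq sq qE]] := f3 s sS.
have [E|ne] := eqVneq (f v) s; last first.
  exists q; split=> // x; rewrite qE !inE; have [->|xw] := eqVneq x w.
    by rewrite (negPf ne) andbF.
  by [].
have vq : v \in q by rewrite qE inE vUw E eqxx.
have wq : w \notin q by rewrite qE !inE eqxx.
case/splitPr: vq qE uq sq wq => q1 q2 qE uq sq wq.
have [| | | |q' pq' pvq'] := @path_insert_out v w q2.
- move: sq; rewrite -cat_rcons; case: (q1) => [|a r] //=.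
  by rewrite cat_path last_rcons => /andP[].
- by [].
- by apply: contra wq; rewrite mem_cat inE => ->; rewrite !orbT.
- move=> x xq2; apply: near_w; have := qE x.
  by rewrite mem_cat inE xq2 !orbT !inE => /esym/andP[/andP[]].
have pp : perm_eq (q1 ++ v :: q') (w :: q1 ++ v :: q2).
  rewrite -cat_rcons -[q1 ++ v :: q2]cat_rcons -[w :: _]cat1s perm_sym perm_catCA
    perm_sym.
  by rewrite perm_cat2l.
exists (q1 ++ v :: q'); split.
- by rewrite (perm_uniq pp) /= wq.
- move: sq; case: (q1) => [|a r] /=; rewrite ?pvq' //.
  by rewrite !cat_path /= pvq' => /and3P[-> -> _].
- move=> x; rewrite (perm_mem pp) [in LHS]inE qE !inE.
  by have [->|xw] := eqVneq x w; rewrite ?wU ?E ?eqxx.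
Qed.

Lemma S_paths_split (U M S : {set T}) f1 f2 :
  M \subset U -> S \subset U ->
  S_paths M (S :&: M) f1 -> S_paths (U :\: M) (S :\: M) f2 ->
  exists f, S_paths U S f.
Proof.
move=> MU SU [a1 a2 a3] [b1 b2 b3].
exists (fun x => if x \in M then f1 x else f2 x); split.
- move=> x xU; case: ifP => xM; first by have := a1 x xM; rewrite inE => /andP[].
  by have := b1 x; rewrite !inE xM xU => /(_ isT)/andP[].
- by move=> s sS; case: ifP => sM; [apply: a2|apply: b2]; rewrite inE sM sS.
move=> s sS; have [sM|sM] := boolP (s \in M).
  have [|q [uq sq qE]] := a3 s; first by rewrite inE sS.
  exists q; split=> // x; rewrite qE !inE; case: (boolP (x \in M)) => xM /=.
    by rewrite (subsetP MU).
  case: (boolP (x \in U)) => //= xU; apply/esym/negbTE.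
  by have := b1 x; rewrite !inE xM xU => /(_ isT)/andP[+ _]; apply: contraNneq => ->.
have [|q [uq sq qE]] := b3 s; first by rewrite inE sM.
exists q; split=> // x; rewrite qE !inE; case: (boolP (x \in M)) => xM //=.
rewrite (subsetP MU) //=; apply/esym/negbTE; apply: contraNneq sM => <-.
by have := a1 x xM; rewrite inE => /andP[].
Qed.

(** An independent set on one side can be combined with the part of [S] on the other. *)
Lemma maximum_independent_split (U M S : {set T}) :
  M \subset U -> {in M & U :\: M, forall x y, ~~ adj x y} ->
  maximum_independent adj U S ->
  maximum_independent adj M (S :&: M) /\ maximum_independent adj (U :\: M) (S :\: M).
Proof.
move=> MU sep [SU iS mS].
have cS := cardsID M S.
have bound (X Y : {set T}) : X \subset M -> Y \subset U :\: M ->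
    independent adj X -> independent adj Y -> #|X| + #|Y| <= #|S|.
  move=> XM YM iX iY.
  have dXY : [disjoint X & Y].
    rewrite -setI_eq0; apply/eqP/setP => x; rewrite !inE.
    apply/negP => /andP[/(subsetP XM) xM /(subsetP YM)].
    by rewrite inE xM.
  move: (dXY); rewrite -leq_card_setU => /eqP <-; apply: mS.
    by rewrite subUset (subset_trans XM) //= (subset_trans YM) ?subsetDl.
  move=> x y; rewrite !inE => /orP[xX|xY] /orP[yX|yY].
  - exact: iX.
  - by apply: sep; [apply: (subsetP XM)|apply: (subsetP YM)].
  - by rewrite adj_sym; apply: sep; [apply: (subsetP XM)|apply: (subsetP YM)].
  - exact: iY.
have iM : independent adj (S :&: M) := independentS (subsetIl _ _) iS.
have iD : independent adj (S :\: M) := independentS (subsetDl _ _) iS.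
split; split=> //.
- exact: subsetIr.
- move=> X XM iX; have := bound X _ XM (setSD M SU) iX iD; lia.
- exact: setSD.
- move=> Y YM iY; have := bound _ Y (subsetIr S M) YM iM iY; lia.
Qed.

(** Each [b] is inserted right after [h b]; the next vertex of the path is an out-neighbour of
    [h b], hence of [b]. *)
Lemma S_paths_append_all (U S B : {set T}) (h : T -> T) f :
  B \subset U -> [disjoint B & S] ->
  {in B, forall b, h b \in U :\: B} -> {in B &, injective h} ->
  {in B, forall b, e (h b) b} ->
  {in B & U :\: B, forall b x, e (h b) x -> e b x} ->
  S_paths (U :\: B) S f -> exists f', S_paths U S f'.
Proof.
move=> BU BS hU hI hb hx [f1 f2 f3].
exists (fun x => if x \in B then f (h x) else f x); split.
- move=> x xU; case: ifP => xB; first by apply/f1/hU.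
  by apply: f1; rewrite inE xB.
- move=> s sS; rewrite ifN ?f2 //.
  by move: BS; rewrite disjoint_sym => /disjointFr/(_ sS) ->.
move=> s sS; have [q [uq sq qE]] := f3 s sS.
pose opt x := [seq b <- enum B | h b == x].
pose ext x := x :: opt x.
have optP x : opt x = [::] \/ exists2 b, b \in B & h b = x /\ opt x = [:: b].
  have : uniq (opt x) by rewrite filter_uniq ?enum_uniq.
  have memo b : b \in opt x -> b \in B /\ h b = x.
    by rewrite mem_filter mem_enum => /andP[/eqP].
  case: (opt x) memo => [|b [|b' s']] memo uo; first by left.
    by right; have [bB hbx] := memo b (mem_head _ _); exists b.
  have [bB hbx] := memo b (mem_head _ _).
  have [|b'B hb'x] := memo b'; first by rewrite !inE eqxx orbT.
  by move: uo; rewrite (hI b b') ?hbx //= inE eqxx.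
have qU : {subset q <= U :\: B} by move=> x; rewrite qE inE => /andP[].
have memE z r : {subset r <= U :\: B} -> (z \in flatten [seq ext x | x <- r]) =
    (z \in r) || ((z \in B) && (h z \in r)).
  move=> rU; apply/flatten_mapP/orP.
    case=> x xr; rewrite inE => /orP[/eqP ->|]; first by left.
    by rewrite mem_filter mem_enum => /andP[/eqP -> ->]; right.
  case=> [zr|/andP[zB hz]]; first by exists z => //; apply: mem_head.
  by exists (h z) => //; rewrite inE mem_filter eqxx mem_enum zB orbT.
have subt (x : T) r : {subset x :: r <= U :\: B} -> {subset r <= U :\: B}.
  by move=> H y yr; apply: H; rewrite inE yr orbT.
exists (flatten [seq ext x | x <- q]); split.
- elim: (q) uq qU => [//|x r IH] /= /andP[xr ur] xrU; have rU := subt x r xrU.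
  have xU := xrU x (mem_head _ _); move: (xU); rewrite inE => /andP[xB _].
  rewrite mem_cat negb_or memE // (negPf xr) (negPf xB) /= andbT cat_uniq IH // andbT.
  rewrite [uniq (opt x)]filter_uniq ?enum_uniq //= mem_filter mem_enum (negPf xB).
  rewrite andbF /=.
  apply/hasPn => y; rewrite memE // mem_filter mem_enum => /orP[/rU|/andP[yB hy]].
    by rewrite inE => /andP[/negPf ->]; rewrite andbF.
  by rewrite yB andbT; apply: contraNneq xr => <-.
- have: forall x r, path e x r -> {subset x :: r <= U :\: B} ->
      path e x (opt x ++ flatten [seq ext y | y <- r]).
    move=> x r; elim: r x => [|y r IH] x /=.
      move=> _ _; rewrite cats0; case: (optP x) => [->//|[b bB [<- ->]]] /=.
      by rewrite hb.
    case/andP => xy pr xrU; have := IH y pr (subt _ _ xrU) => py.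
    case: (optP x) => [->|[b bB [hbx ->]]] /=; first by rewrite xy.
    rewrite -{1}hbx hb // hx ?hbx //; apply: xrU.
    by rewrite !inE eqxx orbT.
  by case: (q) sq qU => [//|x r] /= pr xrU; apply.
- move=> z; rewrite memE // !qE !inE.
  have [zB|zB] := boolP (z \in B) => /=; last by rewrite orbF.
  by have := hU z zB; rewrite inE => /andP[-> ->]; rewrite (subsetP BU).
Qed.

Lemma injection_of_card (B A : {set T}) : #|B| <= #|A| ->
  exists h : T -> T, {in B, forall b, h b \in A} /\ {in B &, injective h}.
Proof.
move=> BA; exists (fun b => nth b (enum A) (index b (enum B))).
have idx b : b \in B -> index b (enum B) < size (enum A).
  by move=> bB; rewrite -cardE (leq_trans _ BA) // cardE index_mem mem_enum.
split=> [b bB|b b' bB b'B].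
  by rewrite -mem_enum mem_nth ?idx.
rewrite (set_nth_default b') ?idx // => /eqP.
rewrite nth_uniq ?enum_uniq ?idx // => /eqP E.
by rewrite -[b](nth_index b (s := enum B)) ?mem_enum // E nth_index ?mem_enum.
Qed.

Import GRing.Theory.

(** * Extended odd cycles *)

Section ExtendedCycle.
Variable m : nat.
(** The cycle has length [m + 5], and its indices are computed modulo [m + 5]. *)
Local Notation Zn := 'I_m.+4.+1.
Hypothesis m_even : ~~ odd m.
Lemma natr_small (k : nat) : k < 5 -> (k%:R == 0 :> Zn)%R = (k == 0).
Proof.
move=> k5; rewrite -val_eqE /= (@val_Zp_nat m.+4.+1) // modn_small //.
exact: leq_trans k5 _.
Qed.

Lemma shift_eq (i : Zn) a b : a < 5 -> b < 5 -> (i + a%:R == i + b%:R)%R = (a == b).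
Proof.
rewrite (inj_eq (addrI i)) => a5 b5; wlog ab : a b a5 b5 / a <= b.
  by move=> H; case: (leqP a b) => [/H ->//|/ltnW/H];
    rewrite eq_sym => ->; rewrite // eq_sym.
rewrite eq_sym -subr_eq0 -natrB // natr_small; last by apply: leq_ltn_trans b5; apply: leq_subr.
by rewrite subn_eq0 eq_sym eqn_leq ab andbC.
Qed.

Lemma shift_id (i : Zn) a : a < 5 -> (i + a%:R == i)%R = (a == 0).
Proof. by move=> a5; rewrite -{2}[i]addr0 -[X in (_ == _ + X)%R]/(0%:R)%R shift_eq. Qed.

Lemma shift1_id (i : Zn) : (i + 1 == i)%R = false.
Proof. exact: (@shift_id i 1). Qed.

(* A is a directed cycle of length m + 5 in which each vertex i is replaced by a
   non-empty stable set of vertices, those with label l equal to i. *)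
Definition extended_cycle (U A : {set T}) (l : T -> Zn) : Prop :=
  [/\ A \subset U, {in A &, forall x y, e x y = (l y == l x + 1)%R}
    & forall i, exists2 x, x \in A & l x = i].

Variables (U A : {set T}) (l : T -> Zn).
Hypothesis cycleA : extended_cycle U A l.
Hypothesis maxA : forall A' l', extended_cycle U A' l' -> #|A'| <= #|A|.

Let AU x : x \in A -> x \in U.
Proof. by have [/subsetP H _ _] := cycleA; apply: H. Qed.

Let arcA x y : x \in A -> y \in A -> e x y = (l y == l x + 1)%R.
Proof. by have [_ H _] := cycleA; apply: H. Qed.

Let pickA i : exists2 x, x \in A & l x = i.
Proof. by have [_ _] := cycleA. Qed.

Let nearA x y : x \in A -> y \in A -> near x y ->
  [\/ l y = l x, l y = (l x + 1)%R | l x = (l y + 1)%R].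
Proof.
move=> xA yA /near_cases[->|xy|yx]; first by constructor 1.
  by constructor 2; apply/eqP; rewrite -arcA.
by constructor 3; apply/eqP; rewrite -arcA.
Qed.

Let shift i a b : (i + a%:R + b%:R)%R = (i + (a + b)%:R)%R :> Zn.
Proof. by rewrite natrD addrA. Qed.

Let shift1 i : (i + 1 + 1)%R = (i + 2%:R)%R :> Zn.
Proof. by rewrite -addrA. Qed.

Lemma out_label_step v x y : x \in A -> y \in A -> e v x -> e v y ->
  exists2 k, k <= 2 & l y = (l x + k%:R)%R.
Proof.
move=> xA yA vx vy; have [b bA lb] := pickA (l x + 1)%R.
have xb : e x b by rewrite arcA ?lb.
case: (nearA yA bA (out_near vx vy xb)); rewrite lb => E.
- by exists 1.
- by exists 0; rewrite // addr0; apply: (addIr 1%R).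
- by exists 2; rewrite // E shift1.
Qed.

(** The label differences in both directions are at most 2 and sum to 0 modulo a length of at least
    5, so both vanish. *)
Lemma out_label v x y : x \in A -> y \in A -> e v x -> e v y -> l x = l y.
Proof.
move=> xA yA vx vy; have [a a2 Ea] := out_label_step xA yA vx vy.
have [b b2 Eb] := out_label_step yA xA vy vx.
have : (l x + 0%:R == l x + (a + b)%:R)%R by rewrite -shift -Ea -Eb addr0.
rewrite shift_eq //; last by lia.
by move=> E; rewrite Ea (_ : a = 0) ?addr0 //; lia.
Qed.

(** Such a [v] could be added to [A] with label [l x + 1], against [maxA]. *)
Lemma not_in_and_out v x y : v \in U -> v \notin A -> x \in A -> y \in A ->
  e x v -> e v y -> False.
Proof.
move=> vU vA xA yA.
have neqA z : z \in A -> v != z by apply: contraTneq => <-.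
have d x' y' : x' \in A -> y' \in A -> e x' v -> e v y' ->
    exists2 k, k <= 2 & l y' = (l x' + k%:R)%R.
  move=> x'A y'A xv vy; have [b bA lb] := pickA (l x' + 1)%R.
  have xb : e x' b by rewrite arcA ?lb.
  case: (nearA bA y'A (out_near xv xb vy)); rewrite lb => E.
  - by exists 1.
  - by exists 2; rewrite // E shift1.
  - by exists 0; rewrite // addr0; apply/esym/(addIr 1%R).
have two x' y' : x' \in A -> y' \in A -> e x' v -> l y' = (l x' + 2%:R)%R -> adj v y'.
  move=> x'A y'A xv ly; have [b bA lb] := pickA (l x' + 1)%R.
  apply: near_adj (neqA _ y'A); apply: (@out_near x' b) => //; rewrite arcA ?lb //.
  by rewrite ly shift1.
(* If [z] has an arc to [v], then [a] equals [2 + b] modulo the length, with [a] and [b] at most 2;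
   the length being at least 5, this forces [a = 2]. *)
have lab x' y' : x' \in A -> y' \in A -> e x' v -> e v y' -> l y' = (l x' + 2%:R)%R.
  move=> x'A y'A xv vy; have [z zA lz] := pickA (l x' + 2%:R)%R.
  have /orP[vz|zv] := two x' z x'A zA xv lz; first by rewrite (out_label y'A zA vy vz).
  have [a a2 Ea] := d _ _ x'A y'A xv vy; have [b b2 Eb] := d _ _ zA y'A zv vy.
  have : (l x' + a%:R == l x' + (2 + b)%:R)%R by rewrite -shift -lz -Eb Ea.
  rewrite shift_eq //; [move=> E|lia].
  by rewrite Ea (_ : a = 2) //; lia.
move=> xv vy; pose l' z := if z == v then (l x + 1)%R else l z.
suff : extended_cycle U (v |: A) l'.
  by move/maxA; rewrite cardsU1 vA ltnn.
have lA z : z \in A -> l' z = l z by move/neqA; rewrite /l' eq_sym => /negPf ->.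
have lv : l' v = (l x + 1)%R by rewrite /l' eqxx.
have ly := lab x y xA yA xv vy.
have outv z : z \in A -> e v z = (l z == l x + 2%:R)%R.
  move=> zA; apply/idP/eqP => [vz|lz]; first exact: lab.
  have /orP[//|zv] := two x z xA zA xv lz.
  have := lab z y zA yA zv vy; rewrite ly lz => /eqP.
  by rewrite shift shift_eq.
have inv z : z \in A -> e z v = (l z == l x).
  move=> zA; apply/idP/eqP => [zv|lz].
    by have := lab z y zA yA zv vy; rewrite ly => /(addIr _).
  have [w wA lw] := pickA (l x - 1)%R.
  have wx : e w x by rewrite arcA // lw subrK.
  have wz : e w z by rewrite arcA // lw subrK lz.
  have := near_adj (out_near wx wz xv); rewrite eq_sym => /(_ (neqA z zA)).
  case/orP => // vz; have := lab x z xA zA xv vz; rewrite lz => /esym/eqP.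
  by rewrite shift_id.
split.
- by rewrite subUset sub1set vU; apply/subsetP.
- move=> a b /setU1P[->|aA] /setU1P[->|bA]; rewrite ?lv ?lA //.
  + rewrite eirr; apply/esym/negbTE; by rewrite eq_sym shift1_id.
  + by rewrite outv // shift1.
  + rewrite inv // eq_sym; apply/eqP/eqP => [->//|]; exact: addIr.
  + exact: arcA.
- move=> i; have [z zA lz] := pickA i; exists z; first exact: setU1r.
  by rewrite lA.
Qed.

(** Domination of [v] passes from one label to the label two further on, since by [not_in_and_out]
    no arc can point back. As the length is odd, steps of 2 reach every label. *)
Lemma dominated_by_cycle v x : v \in U -> v \notin A -> x \in A -> e x v ->
  {in A, forall y, e y v}.
Proof.
move=> vU vA xA xv.
have step x' y : x' \in A -> e x' v -> y \in A -> l y = (l x' + 2%:R)%R -> e y v.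
  move=> x'A x'v yA ly; have [b bA lb] := pickA (l x' + 1)%R.
  have vy : v != y by apply: contraNneq vA => ->.
  have : adj v y.
    apply: near_adj vy; apply: (@out_near x' b) => //; rewrite arcA ?lb //.
    by rewrite ly shift1.
  by case/orP => // vy'; case: (not_in_and_out vU vA xA yA xv vy').
have all_even t : exists2 x', x' \in A & l x' = (l x + (2 * t)%:R)%R /\ e x' v.
  elim: t => [|t [x' x'A [lx' x'v]]]; first by exists x; rewrite // muln0 addr0.
  have [y yA ly] := pickA (l x' + 2%:R)%R; exists y => //; split.
    by rewrite ly lx' shift mulnS addnC.
  exact: step x'v yA ly.
move=> y yA; pose d := val (l y - l x)%R.
(* [(m.+4)./2.+1] is the inverse of 2 modulo [m + 5]. The summand [m.+4] and the closing step of 2,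
   which reaches every vertex of the label, together add twice the length. *)
have [z zA [lz zv]] := all_even (d * (m.+4)./2.+1 + m.+4)%N.
have E : (l x + d%:R = l y)%R by rewrite natr_Zp addrC subrK.
apply: step zv yA _ => //; rewrite lz shift -E; congr (_ + _)%R.
have n0 : (m.+4.+1%:R = 0 :> Zn)%R.
  exact: (@pchar_Zp m.+4.+1).
have -> : (2 * (d * m.+4./2.+1 + m.+4) + 2 = d + m.+4.+1 * (d + 2))%N.
  have : m.+4./2.*2 = m.+4 by rewrite even_halfK //= !negbK.
  nia.
by rewrite natrD natrM n0 mul0r addr0.
Qed.

(** * Distance levels of the vertices that reach the extended cycle *)

Hypothesis closedA : {in A & U, forall x v, e x v -> v \in A}.

Fixpoint within (k : nat) : {set T} :=
  if k is k'.+1 then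
    within k' :|: [set v in U | [exists w in within k', e v w]]
  else A.

Lemma withinS k : within k \subset within k.+1.
Proof. exact: subsetUl. Qed.

Lemma within_arc k v w : v \in U -> w \in within k -> e v w -> v \in within k.+1.
Proof.
by move=> vU wk vw; rewrite /= !inE vU; apply/orP; right; apply/exists_inP; exists w.
Qed.

Lemma within_succ k v : v \in within k.+1 -> v \notin within k ->
  exists2 w, w \in within k & e v w.
Proof.
by rewrite /= !inE => /orP[-> //|/andP[_ /exists_inP[w wk vw]]] _; exists w.
Qed.

Lemma withinU k v : v \in within k -> v \in U.
Proof.
by elim: k => [|k IH] /=; [apply: AU|rewrite !inE => /orP[/IH|/andP[]]].
Qed.

(** Some out-neighbour [r] of [v] has an arc to an [s] in level [k], and [p] is near [s]; closedness
    of level [k] leaves only an arc from [p] to [s]. *)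
Lemma within_exact k v p : {in within k & U, forall v p, e v p -> p \in within k} ->
  v \in within k.+2 -> v \notin within k.+1 -> p \in U -> e v p ->
  (p \in within k.+1) && (p \notin within k).
Proof.
move=> closed v2 v1 pU vp; have vU := withinU v2.
have [r r1 vr] := within_succ v2 v1.
have rk : r \notin within k.
  by apply: contra v1 => rk; apply: within_arc vr.
have [s sk rs] := within_succ r1 rk.
have pk : p \notin within k.
  by apply: contra v1 => pk; apply: within_arc vp.
rewrite pk andbT; case: (near_cases (out_near vr vp rs)) => [E|ps|sp].
- by rewrite E sk in pk.
- exact: within_arc ps.
- by rewrite (closed s p) in pk.
Qed.

(** Two consecutive levels are treated together, because [within_exact] obtains level [k + 2] from
    the closedness of level [k]. *)
Lemma within_closed k : {in within k & U, forall v p, e v p -> p \in within k}.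
Proof.
suff [] : {in within k & U, forall v p, e v p -> p \in within k} /\
  {in within k.+1 & U, forall v p, e v p -> p \in within k.+1} by [].
elim: k => [|k [IH1 IH2]]; split=> //.
- move=> v p v1 pU vp; have [vA|vA] := boolP (v \in A).
    by apply: (subsetP (withinS 0)); apply: closedA vp.
  have [a aA va] := within_succ v1 vA.
  have [b bA lb] := pickA (l a + 1)%R.
  have ab : e a b by rewrite arcA ?lb.
  case: (near_cases (out_near va vp ab)) => [->|pb|bp].
  + exact: (subsetP (withinS 0)).
  + exact: within_arc pb.
  + by apply: (subsetP (withinS 0)); apply: closedA bp.
- move=> v p v2 pU vp; have [v1|v1] := boolP (v \in within k.+1).
    by apply: (subsetP (withinS _)); apply: IH2 vp.
  have /andP[p1 _] := within_exact IH1 v2 v1 pU vp.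
  exact: (subsetP (withinS _)).
Qed.

Lemma reach_within v : v \in U -> (exists2 a, a \in A & connect (arc_in U) v a) ->
  exists k, v \in within k.
Proof.
move=> vU [a aA /connectP[s ps E]].
elim: s v vU ps E => [|w s IH] v vU /=; first by move=> _ <-; exists 0.
case/andP => /and3P[_ wU vw] ps E; have [k wk] := IH w wU ps E.
by exists k.+1; apply: within_arc vw.
Qed.

Lemma within_reach k v : v \in within k ->
  exists2 a, a \in A & connect (arc_in U) v a.
Proof.
elim: k v => [|k IH] v /=; first by exists v; rewrite ?connect0.
rewrite !inE => /orP[/IH //|/andP[vU /exists_inP[w wk vw]]].
have [a aA wa] := IH w wk; exists a => //; apply: connect_trans wa.
by apply: connect1; rewrite /= vU (withinU wk).
Qed.

Lemma basin_separated :
  let M := [set v in U | [exists a in A, connect (arc_in U) v a]] in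
  {in M & U :\: M, forall x y, ~~ adj x y}.
Proof.
move=> M x y; rewrite !inE => /andP[xU /exists_inP xM] /andP[yM yU].
apply: contra yM; rewrite yU => /orP[xy|yx].
  have [k xk] := reach_within xU xM.
  have [a aA ya] := within_reach (within_closed xk yU xy).
  by apply/exists_inP; exists a.
have [a aA xa] := xM; apply/exists_inP; exists a => //.
by apply: connect_trans xa; apply: connect1; rewrite /= yU xU.
Qed.

Hypothesis reachA : {in U, forall v, exists2 a, a \in A & connect (arc_in U) v a}.

(** [r] models the distance to [A]. The last clause is restricted to ranks above 1, as arcs between
    vertices of rank 1 may occur. *)
Definition is_rank (r : T -> nat) : Prop :=
  [/\ {in U, forall v, (v \in A) = (r v == 0)},
      {in U, forall v, r v = 1 -> exists2 a, a \in A & e v a},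
      {in U &, forall v p, e v p -> r p <= r v}
    & {in U &, forall v p, e v p -> 1 < r v -> r v = (r p).+1}].

Lemma rank_exists : exists r, is_rank r.
Proof.
have /fin_all_exists[r rP] (v : T) : exists k, v \in U ->
    v \in within k /\ forall j, v \in within j -> k <= j.
  have [vU|] := boolP (v \in U); last by exists 0.
  have ex := reach_within vU (reachA vU); exists (ex_minn ex) => _.
  by case: ex_minnP.
have step v k : v \in U -> r v = k.+1 -> v \notin within k.
  move=> vU rv; have [_ minr] := rP v vU.
  by apply/negP => /minr; rewrite rv ltnn.
have noninc : {in U &, forall v p, e v p -> r p <= r v}.
  move=> v p vU pU vp; have [_ minp] := rP p pU; apply: minp.
  by apply: within_closed vp => //; case: (rP v vU).
exists r; split=> //.
- move=> v vU; have [vr minr] := rP v vU; apply/idP/eqP => [vA|r0].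
    by apply/eqP; rewrite -leqn0; apply: (minr 0).
  by rewrite r0 in vr.
- move=> v vU r1; have := rP v vU; rewrite r1 => -[v1 _].
  exact: (within_succ v1 (step v 0 vU r1)).
- move=> v p vU pU vp rv; case rvE : (r v) rv => [|[|k]] // _.
  have [v2 _] := rP v vU; rewrite rvE in v2.
  have /andP[p1 pk] :=
    within_exact (@within_closed k) v2 (step v _ vU rvE) pU vp.
  have [pr minp] := rP p pU.
  suff : k < r p by have := minp _ p1; lia.
  rewrite ltnNge; apply: contra pk => rk.
  move: pr; rewrite -(subnK rk); elim: (k - r p) => [|j IHj]; first by [].
  by move/IHj/(subsetP (withinS _)).
Qed.

Definition class i := [set x in A | l x == i].

Lemma classP i x : reflect (x \in A /\ l x = i) (x \in class i).
Proof. by rewrite inE; apply: (iffP andP) => -[-> /eqP]. Qed.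

Lemma class_adj i x y : x \in class i -> y \in class (i + 1)%R -> e x y.
Proof. by move=> /classP[xA lx] /classP[yA ly]; rewrite arcA ?lx ?ly. Qed.

Lemma class_nonempty i : exists x, x \in class i.
Proof. by have [x xA lx] := pickA i; exists x; apply/classP. Qed.

Lemma classU i x : x \in class i -> x \in U.
Proof. by case/classP => /AU. Qed.

Lemma arc_to_next_class r x y a b :
  (forall v, v \in U -> (v \in A) = (r v == 0)) ->
  x \in U -> y \in U -> r y = 1 -> e x y -> a \in A -> b \in A -> e x a ->
  e a b -> e y b.
Proof.
move=> rA xU yU ry xy aA bA xa ab.
have yA : y \notin A by rewrite rA // ry.
case: (near_cases (out_near xa xy ab)) => [E|//|b_y].
  by rewrite E bA in yA.
by rewrite (closedA bA yU b_y) in yA.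
Qed.

(** * Triangles and odd cycles in the presence of a rank *)

Section Ranked.
Variable r : T -> nat.
Hypothesis rank_r : is_rank r.

Let rA : {in U, forall v, (v \in A) = (r v == 0)}.
Proof. by case: rank_r. Qed.

Let r1A : {in U, forall v, r v = 1 -> exists2 a, a \in A & e v a}.
Proof. by case: rank_r. Qed.

Let r_le : {in U &, forall v p, e v p -> r p <= r v}.
Proof. by case: rank_r. Qed.

Let r_dec : {in U &, forall v p, e v p -> 1 < r v -> r v = (r p).+1}.
Proof. by case: rank_r. Qed.

(** [x], [y], [z] have arcs to [a], [b], [c] of consecutive labels; but [z] must also have an arc to
    [a], against [out_label]. *)
Lemma no_two_steps x y z : x \in U -> y \in U -> z \in U ->
  r x = 1 -> r y = 1 -> r z = 1 -> e x y -> e y z -> False.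
Proof.
move=> xU yU zU rx ry rz xy yz; have [a aA xa] := r1A xU rx.
have [b bA lb] := pickA (l a + 1)%R; have ab : e a b by rewrite arcA ?lb.
have yb := arc_to_next_class rA xU yU ry xy aA bA xa ab.
have [c cA lc] := pickA (l b + 1)%R; have bc : e b c by rewrite arcA ?lc.
have zc := arc_to_next_class rA yU zU rz yz bA cA yb bc.
have zA : z \notin A by rewrite rA // rz.
case: (near_cases (out_near xy xa yz)) => [E|az|za].
- by rewrite -E aA in zA.
- by rewrite (closedA aA zU az) in zA.
- have := out_label aA cA za zc; rewrite lc lb shift1 => /esym/eqP.
  by rewrite shift_id.
Qed.

Lemma rank1 v : v \in U -> v \notin A -> r v <= 1 -> r v = 1.
Proof. by move=> vU; rewrite rA //; case: (r v) => [|[|]]. Qed.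

(** Ranks above 1 drop by exactly one per arc, so what remains are triangles close to [A], excluded
    by the labels, by [closedA] or by [no_two_steps]. *)
Lemma triangle_free_basin : triangle_free U.
Proof.
move=> x y z xU yU zU; apply/negP => /and3P[xy yz xz].
have [w wU] := adjacent_triple_on_triangle xU yU zU xy yz xz.
case=> [[{xy yz xz}x [{}y [{}xU {}yU xy xw yw]]]|
        [{xy yz xz}x [{}y [{}xU {}yU wx xy yw]]]].
  have [rx|rx] := leqP (r x) 1; last first.
    have ry := r_dec xU yU xy rx; have rw := r_dec xU wU xw rx.
    have E : r y = r w by apply: succn_inj; rewrite -ry.
    have ry1 : r y = 1.
      apply/eqP; rewrite eqn_leq -[0 < _]ltnS -ry rx andbT leqNgt.
      by apply/negP => /(r_dec yU wU yw); rewrite E; apply: n_Sn.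
    have rw1 : r w = 1 by rewrite -E.
    have [a aA ya] := r1A yU ry1.
    have [b bA lb] := pickA (l a + 1)%R; have ab : e a b by rewrite arcA ?lb.
    have wb := arc_to_next_class rA yU wU rw1 yw aA bA ya ab.
    have wA : w \notin A by rewrite rA // rw1.
    case: (near_cases (out_near xy xw ya)) => [wa|wa|aw].
    - by rewrite wa aA in wA.
    - by have /esym/eqP := out_label aA bA wa wb; rewrite lb shift1_id.
    - by rewrite (closedA aA wU aw) in wA.
  have [xA|xA] := boolP (x \in A).
    have yA := closedA xA yU xy; have wA := closedA xA wU xw.
    move: xy xw yw; rewrite !arcA // => /eqP -> /eqP ->.
    by rewrite eq_sym shift1_id.
  have rx1 := rank1 xU xA rx.
  have [yA|yA] := boolP (y \in A).
    have wA := closedA yA wU yw.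
    have := out_label yA wA xy xw; move: yw; rewrite arcA // => /eqP -> /esym/eqP.
    by rewrite shift1_id.
  have ry1 := rank1 yU yA (leq_trans (r_le xU yU xy) rx).
  have [wA|wA] := boolP (w \in A).
    have [b bA lb] := pickA (l w + 1)%R; have wb : e w b by rewrite arcA ?lb.
    have yb := arc_to_next_class rA xU yU ry1 xy wA bA xw wb.
    have := out_label wA bA yw yb; rewrite lb => /esym/eqP.
    by rewrite shift1_id.
  have rw1 := rank1 wU wA (leq_trans (r_le xU wU xw) rx).
  exact: no_two_steps xU yU wU rx1 ry1 rw1 xy yw.
have le1 := r_le wU xU wx; have le2 := r_le xU yU xy; have le3 := r_le yU wU yw.
have [rw|rw] := leqP (r w) 1; last first.
  by have := leq_trans le3 le2; rewrite (r_dec wU xU wx rw) ltnn.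
have [wA|wA] := boolP (w \in A).
  have xA := closedA wA xU wx; have yA := closedA xA yU xy.
  move: wx xy yw; rewrite !arcA // => /eqP -> /eqP ->.
  by rewrite shift1 -addrA eq_sym (@shift_id _ 3).
have yA : y \notin A by apply: contra wA => yA; apply: closedA yw.
have xA : x \notin A by apply: contra yA => xA; apply: closedA xy.
exact: (no_two_steps wU xU yU (rank1 wU wA rw) (rank1 xU xA (leq_trans le1 rw))
  (rank1 yU yA (leq_trans le2 (leq_trans le1 rw))) wx xy).
Qed.

(** Ranks never increase along the cycle, so they are at most 1. A cycle meeting [A] stays in [A]
    and runs through every label; one avoiding [A] contradicts [no_two_steps]. *)
Lemma no_odd_dicycle_without_class i : ~ induced_odd_dicycle (U :\: class i).
Proof.
move=> [n [c [on n5 cU ec]]].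
have cS k : e (c k) (c k.+1) by rewrite ec.
have cU' k : c k \in U by have := cU k; rewrite inE => /andP[].
have cback k : e (c (k + n.-1)) (c k).
  rewrite ec -addnS prednK ?modnDr //; lia.
have noninc j k : r (c (j + k)) <= r (c j).
  elim: k => [|k IH]; first by rewrite addn0.
  by rewrite addnS; apply: leq_trans IH; apply: r_le.
have r1 k : r (c k) <= 1.
  rewrite leqNgt; apply/negP => rk.
  have := r_dec (cU' k) (cU' k.+1) (cS k) rk.
  have := r_le (cU' _) (cU' k) (cback k); have := noninc k.+1 n.-2.
  rewrite addSnnS (_ : n.-2.+1 = n.-1); lia.
have [[k kA]|notA] := classic (exists k, c k \in A).
  have lk t : c (k + t) \in A /\ l (c (k + t)) = (l (c k) + t%:R)%R.
    elim: t => [|t [IH1 IH2]]; first by rewrite addn0 addr0.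
    have tA : c (k + t.+1) \in A by rewrite addnS; apply: closedA IH1 _ _.
    split=> //; have := cS (k + t); rewrite -addnS arcA // => /eqP ->.
    by rewrite IH2 -[1%R]/(1%:R)%R shift addn1.
  have [cA lc] := lk (val (i - l (c k))%R).
  have := cU (k + val (i - l (c k))%R); rewrite inE => /andP[/negP nc _].
  by apply: nc; apply/classP; split; rewrite // lc natr_Zp addrC subrK.
have r1' k : r (c k) = 1.
  by apply: rank1 (r1 k) => //; apply/negP => ck; apply: notA; exists k.
exact: (no_two_steps (cU' 0) (cU' 1) (cU' 2) (r1' 0) (r1' 1) (r1' 2) (cS 0) (cS 1)).
Qed.

Lemma basin_without_class_bipartite i :
  exists c : T -> bool, {in U :\: class i &, forall x y, adj x y -> c x != c y}.
Proof.
have [K KU cK|c [c2 cP]] := no_induced_odd_dicycle_colouring (m := 2)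
    (@no_odd_dicycle_without_class i).
  rewrite leqNgt; apply/negP => /card_gt2P[x [y [z [[xK yK zK] [xy yz zx]]]]].
  have KU' v : v \in K -> v \in U by move/(subsetP KU); rewrite inE => /andP[].
  have := triangle_free_basin (KU' x xK) (KU' y yK) (KU' z zK).
  by rewrite !cK // eq_sym.
exists (fun x => c x == 1) => x y xU yU /(cP x y xU yU).
by have := c2 x xU; have := c2 y yU; case: (c x) => [|[|]] //; case: (c y) => [|[|]].
Qed.

End Ranked.

Lemma class_neq i x y a b : x \in class (i + a%:R)%R -> y \in class (i + b%:R)%R ->
  a < 5 -> b < 5 -> a != b -> x != y.
Proof.
move=> /classP[_ lx] /classP[_ ly] a5 b5; apply: contraNneq => E.
by rewrite -(shift_eq i) // -lx -ly E.
Qed.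

(** * Chords between two classes at distance two *)

Variable j : Zn.

Definition chord x y :=
  (x \in class j) && (y \in class (j + 2%:R)%R).

Definition chord_adj : rel T := [rel x y | [|| adj x y, chord x y | chord y x]].

Lemma chord_adj_sym : symmetric chord_adj.
Proof. by move=> x y; rewrite /chord_adj /= adj_sym [X in _ || X]orbC. Qed.

Lemma chord_neq x y : chord x y -> x != y.
Proof.
case/andP => xj yj; rewrite -[j]addr0 in xj.
exact: (@class_neq j x y 0 2).
Qed.

Lemma chord_adjxx : irreflexive chord_adj.
Proof.
move=> x; apply/negbTE; rewrite /chord_adj /= adjxx orbb /=.
by apply/negP => /chord_neq; rewrite eqxx.
Qed.

Lemma adj_labels x y : x \in A -> y \in A -> adj x y ->
  l y = (l x + 1)%R \/ l x = (l y + 1)%R.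
Proof. by move=> xA yA; rewrite /adjacent /= !arcA // => /orP[] /eqP; auto. Qed.

Lemma class_chord_independent i : independent chord_adj (class i).
Proof.
move=> x y /classP[xA lx] /classP[yA ly]; apply/negP => /or3P[].
- by move/(adj_labels xA yA) => []; rewrite lx ly => /esym/eqP; rewrite shift1_id.
- case/andP => /classP[_ lxj] /classP[_]; rewrite ly -lx lxj => /esym/eqP.
  by rewrite shift_id.
- case/andP => /classP[_ lyj] /classP[_]; rewrite lx -ly lyj => /esym/eqP.
  by rewrite shift_id.
Qed.

(** Neither edge is a chord, as the classes are independent. Inside [A] the labels leave only
    [j + 1]; outside [A], [v] would have arcs to two different labels, against [out_label]. *)
Lemma common_neighbour a c v : a \in class j -> c \in class (j + 2%:R)%R ->
  v \in U -> chord_adj v a -> chord_adj v c -> v \in class (j + 1)%R.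
Proof.
move=> aj cj vU va vc; have [aA la] := classP _ _ aj; have [cA lc] := classP _ _ cj.
have nvj : v \notin class j.
  by apply/negP => vj; have := class_chord_independent vj aj; rewrite va.
have nvc : v \notin class (j + 2%:R)%R.
  by apply/negP => vj; have := class_chord_independent vj cj; rewrite vc.
have {}va : adj v a.
  by case/or3P: va => //; rewrite /chord ?(negPf nvj) ?(negPf nvc) ?andbF.
have {}vc : adj v c.
  by case/or3P: vc => //; rewrite /chord ?(negPf nvj) ?(negPf nvc) ?andbF.
have [vA|vA] := boolP (v \in A).
  apply/classP; split=> //; case: (adj_labels vA aA va); rewrite la // => E.
  case: (adj_labels vA cA vc) => E'.
    apply: (addIr 1%R); rewrite -E' lc.
    by rewrite -addrA.
  by move/eqP: E; rewrite E' lc shift1 shift eq_sym shift_id.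
have out z : z \in A -> adj v z -> e v z.
  by move=> zA /orP[//|zv]; rewrite (closedA zA vU zv) in vA.
have := out_label aA cA (out a aA va) (out c cA vc); rewrite la lc => /esym/eqP.
by rewrite shift_id.
Qed.

(* The classes j + 2, j + 3, ..., j + n are n - 1 consecutive ones, and n is odd,
   so a proper 2-colouring takes different values on the first and the last. *)
Lemma chord_bipartite r : is_rank r -> exists c : T -> bool,
  {in U :\: class (j + 1)%R &, forall x y, chord_adj x y -> c x != c y}.
Proof.
move=> rank_r; have [c cP] := basin_without_class_bipartite rank_r (j + 1)%R.
have n0 : (m.+4.+1%:R = 0 :> Zn)%R by apply: (@pchar_Zp m.+4.+1).
have natr_neq0 t : 0 < t < m.+4.+1 -> (t%:R != 0 :> Zn)%R.
  move=> /andP[t0 tn]; rewrite -val_eqE /= (@val_Zp_nat m.+4.+1) // modn_small //.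
  by rewrite -lt0n.
have inUD t x : t <= m.+3 -> x \in class (j + 2%:R + t%:R)%R ->
    x \in U :\: class (j + 1)%R.
  move=> tm xj; rewrite inE (classU xj) andbT; apply/negP => /classP[_ lx].
  have /classP[_] := xj; rewrite lx shift => /addrI E.
  have /eqP[] := natr_neq0 t.+1 tm.
  by apply: (addrI 1%R); rewrite addr0 -mulrS -/(2 + t) -E.
have alt t x y : t <= m.+3 -> x \in class (j + 2%:R)%R ->
    y \in class (j + 2%:R + t%:R)%R -> c y = c x (+) odd t.
  elim: t y => [|t IH] y tm xj yj.
    have [z zj] := class_nonempty (j + 2%:R + 1)%R.
    have zU : z \in U :\: class (j + 1)%R by apply: (inUD 1).
    rewrite addr0 in yj.
    have xU : x \in U :\: class (j + 1)%R by apply: (inUD 0); rewrite ?addr0.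
    have yU : y \in U :\: class (j + 1)%R by apply: (inUD 0); rewrite ?addr0.
    have := cP x z xU zU (arc_adj (class_adj xj zj)).
    have := cP y z yU zU (arc_adj (class_adj yj zj)).
    by rewrite addbF; case: (c x); case: (c y); case: (c z).
  have [z zj] := class_nonempty (j + 2%:R + t%:R)%R.
  have cz := IH z (ltnW tm) xj zj.
  have zy : e z y by apply: class_adj zj _; rewrite -[X in (_ + X)%R]/(1%:R)%R shift addn1.
  have := cP z y (inUD t z (ltnW tm) zj) (inUD t.+1 y tm yj) (arc_adj zy).
  by rewrite cz /=; case: (c x); case: (odd t); case: (c y).
have cchord x y : chord x y -> c x != c y.
  (* Class [j] lies [m + 3] steps after class [j + 2], an odd number. *)
  case/andP => xj yj; rewrite (alt m.+3 y x) //.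
    by rewrite /= !negbK; move: m_even; case: (odd m) => //; case: (c y).
  by rewrite shift (_ : 2 + m.+3 = m.+4.+1) // n0 addr0.
exists c => x y xU yU /or3P[xy|/cchord//|/cchord]; first exact: cP.
by rewrite eq_sym.
Qed.

(** If [H] misses class [j] or [j + 2], it contains no chord and no odd dicycle. Otherwise two
    colours suffice outside class [j + 1]; a vertex of that class in [H] lies in a triangle with [a]
    and [c], so a third colour is available for the class. *)
Lemma chord_perfect r : is_rank r -> perfect chord_adj U.
Proof.
move=> rank_r H k HU bH.
have plain i : H \subset U :\: class i ->
    {in H &, forall x y, chord_adj x y -> adj x y} ->
    exists c, colouring chord_adj H k c.
  move=> Hi Ha; have [||c [ck cP]] := @no_induced_odd_dicycle_colouring H k.
  - by move/(induced_odd_dicycleS Hi)/(no_odd_dicycle_without_class rank_r).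
  - move=> K KH cK; apply: bH => // x y xK yK xy.
    by rewrite /chord_adj /= cK.
  - by exists c; split=> // x y xH yH /(Ha x y xH yH); apply: cP.
have miss i : (forall x, x \in H -> x \notin class i) -> H \subset U :\: class i.
  by move=> nH; apply/subsetP => x xH; rewrite inE nH // (subsetP HU).
have [[a aH aj]|na] := classic (exists2 a, a \in H & a \in class j); last first.
  have nH x : x \in H -> x \notin class j.
    by move=> xH; apply/negP => xj; apply: na; exists x.
  apply: (plain j); first exact: miss.
  by move=> x y xH yH; rewrite /chord_adj /= /chord !(negPf (nH _ _)) //= orbF.
have [[c cH cj]|nc] := classic (exists2 c, c \in H & c \in class (j + 2%:R)%R); last first.
  have nH x : x \in H -> x \notin class (j + 2%:R)%R.
    by move=> xH; apply/negP => xj; apply: nc; exists x.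
  apply: (plain (j + 2%:R)%R); first exact: miss.
  by move=> x y xH yH; rewrite /chord_adj /= /chord !(negPf (nH _ _)) // !andbF !orbF.
have ac : chord_adj a c by rewrite /chord_adj /= /chord aj cj /= orbT.
have ac_neq : a != c by apply: contraTneq ac => ->; rewrite chord_adjxx.
have k2 : 1 < k.
  rewrite -[2]/(true.+1) -ac_neq -cards2; apply: bH.
    by rewrite subUset !sub1set aH.
  move=> x y; rewrite !inE => /orP[]/eqP-> /orP[]/eqP->; rewrite ?eqxx //.
  by rewrite chord_adj_sym.
have [d dP] := chord_bipartite rank_r.
have [[b bH' bj]|nb] := classic (exists2 b, b \in H & b \in class (j + 1)%R); last first.
  exists (fun x => d x : nat); split=> [x _|x y xH yH xy].
    by apply: leq_ltn_trans k2; case: (d x).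
  have inD z : z \in H -> z \in U :\: class (j + 1)%R.
    move=> zH; rewrite inE (subsetP HU) // andbT.
    by apply/negP => zj; apply: nb; exists z.
  by have := dP x y (inD x xH) (inD y yH) xy; case: (d x); case: (d y).
have ab : adj a b by apply/arc_adj/(class_adj aj).
have bc : adj b c.
  by apply/arc_adj/(class_adj bj); rewrite shift1.
have k3 : 2 < k.
  have <- : #|[set a; b; c]| = 3.
    rewrite -setUA cardsU1 cards2 !inE negb_or (adj_neq ab) ac_neq.
    by rewrite (adj_neq bc).
  apply: bH; first by rewrite !subUset !sub1set aH bH' cH.
  have [ab' bc'] : chord_adj a b /\ chord_adj b c.
    by rewrite /chord_adj /= ab bc.
  move=> x y; rewrite !inE -!orbA.
  move=> /or3P[]/eqP-> /or3P[]/eqP->; rewrite ?eqxx // => _;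
    by rewrite chord_adj_sym.
exists (fun x => if x \in class (j + 1)%R then 2 else d x : nat).
split=> [x _|x y xH yH xy].
  by case: ifP => // _; apply: leq_ltn_trans k2; case: (d x).
have inD z : z \in H -> z \notin class (j + 1)%R -> z \in U :\: class (j + 1)%R.
  by move=> zH zj; rewrite inE zj (subsetP HU).
case: ifPn => xj; case: ifPn => yj.
- by have := class_chord_independent xj yj; rewrite xy.
- by case: (d y).
- by case: (d x).
- by have := dP x y (inD x xH xj) (inD y yH yj) xy; case: (d x); case: (d y).
Qed.

Definition chord_partition (S : {set T}) (f : T -> T) : Prop :=
  [/\ {in U, forall v, f v \in S}, {in S, forall s, f s = s}
    & {in U &, forall u v, f u = f v -> u != v -> chord_adj u v}].

(** A part containing a chord from [a] to [c] needs some [b] of class [j + 1] to become the path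
    [a b c]. Induction on the number of bad [a]. *)
Lemma chord_partition_repair (S : {set T}) f :
  S \subset U -> [disjoint class (j + 1)%R & S] ->
  #|class j| < #|class (j + 1)%R| -> chord_partition S f ->
  exists2 f', chord_partition S f' &
    forall a c, a \in class j -> c \in class (j + 2%:R)%R -> f' a = f' c ->
    exists2 b, b \in class (j + 1)%R & f' b = f' a.
Proof.
move=> SU disj card_lt.
pose good (f : T -> T) a := [exists b in class (j + 1)%R, f b == f a].
pose bad (f : T -> T) := [set a in class j |
  [exists c in class (j + 2%:R)%R, f a == f c] && ~~ good f a].
have [N] := ubnP #|bad f|; elim: N => // N IH in f *; rewrite ltnS => fN pf.
have [f1 f2 f3] := pf.
have [bad0|[a]] := set_0Vmem (bad f).
  exists f => // a c aj cj ac; have := in_set0 a; rewrite -bad0 inE aj /=.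
  have -> /= : [exists c in class (j + 2%:R)%R, f a == f c].
    by apply/exists_inP; exists c; rewrite // ac.
  by move/negbT; rewrite negbK => /exists_inP[b bj /eqP ba]; exists b.
rewrite inE => /and3P[aj /exists_inP[c cj /eqP ac] ngood].
have [aU cU] := (classU aj, classU cj).
(* A part has at most one vertex of class [j + 1]. If each such part also met class [j], this would
   give an injection of class [j + 1] into class [j], against [card_lt]. *)
have [b bj bfree] : exists2 b, b \in class (j + 1)%R &
    forall a', a' \in class j -> f a' != f b.
  apply: NNPP => no; move: card_lt; rewrite ltnNge => /negP; apply.
  have /fin_all_exists[h hP] (b : T) : exists a', b \in class (j + 1)%R ->
      a' \in class j /\ f a' = f b.
    have [bj|_] := boolP (b \in class (j + 1)%R); last by exists b.
    apply: NNPP => nb; apply: no; exists b => // a' aj'.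
    by apply/eqP => fab; apply: nb; exists a'.
  rewrite -(@card_in_imset _ _ h) => [|b b' bj bj' hbb'].
    apply/subset_leq_card/subsetP => x /imsetP[b bj ->].
    by have [] := hP b bj.
  have [_ E] := hP b bj; have [_ E'] := hP b' bj'; apply/eqP; apply: contraT => nbb'.
  have := class_chord_independent bj bj'.
  by rewrite f3 ?(classU bj) ?(classU bj') // -E -E' hbb'.
have bU := classU bj.
have ab : a != b by apply: contraTneq (bfree a aj) => ->; rewrite eqxx.
have cb : c != b.
  by apply: contraNneq ngood => E; apply/exists_inP; exists b; rewrite // ac E.
have a_adj_b : chord_adj b a.
  by rewrite chord_adj_sym /chord_adj /= (arc_adj (class_adj aj bj)).
have c_adj_b : chord_adj b c.
  rewrite /chord_adj /= (arc_adj (class_adj bj _)) //.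
  by rewrite shift1.
(* Moving [b] repairs [a] and makes no other vertex bad, since the part that [b] leaves has no
   vertex of class [j]. *)
pose f' v := if v == b then f a else f v.
have f'E v : v != b -> f' v = f v by rewrite /f' => /negPf ->.
have f'b : f' b = f a by rewrite /f' eqxx.
(* The part of [a] is only [a] and [c]: a third vertex would be a common neighbour, hence in class
   [j + 1]. *)
have new v : v \in U -> v != b -> f v = f a -> chord_adj b v.
  move=> vU vb va; have [->//|nva] := eqVneq v a; have [->//|nvc] := eqVneq v c.
  have vj : v \in class (j + 1)%R.
    by apply: (common_neighbour aj cj vU); apply: f3; rewrite // va.
  by case/negP: ngood; apply/exists_inP; exists v; rewrite // va.
apply: (IH f').
  apply: leq_trans fN; apply: proper_card; apply/properP; split; last first.
    exists a.
      by rewrite inE aj ngood andbT; apply/exists_inP; exists c; rewrite // ac.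
    rewrite inE aj /= negb_and; apply/orP; right; rewrite negbK.
    by apply/exists_inP; exists b; rewrite // f'b f'E.
  apply/subsetP => x; rewrite inE => /and3P[xj /exists_inP[d dj /eqP xd] ngx].
  have xb : x != b by apply: contraTneq (bfree x xj) => ->; rewrite eqxx.
  have db : d != b.
    apply: contraNneq ngx => E; apply/exists_inP; exists b => //.
    by rewrite xd E.
  rewrite inE xj -(f'E x xb) /=; apply/andP; split.
    by apply/exists_inP; exists d; rewrite // -(f'E d db) xd.
  apply: contra ngx => /exists_inP[b' bj' /eqP E].
  have b'b : b' != b.
    by apply: contraTneq (bfree x xj) => E'; rewrite -E E' eqxx.
  by apply/exists_inP; exists b'; rewrite // !f'E // E.
split.
- by move=> v vU; rewrite /f'; case: ifP => _; apply: f1.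
- move=> s sS; rewrite f'E ?f2 //; apply: contraTneq sS => ->.
  by rewrite (disjointFr disj bj).
move=> u v uU vU; have [->|ub] := eqVneq u b; have [->|vb] := eqVneq v b.
- by [].
- by rewrite f'b f'E // => /esym va _; apply: new.
- by rewrite f'b f'E // => ua _; rewrite chord_adj_sym; apply: new.
- by rewrite !f'E //; apply: f3.
Qed.

(** As [S] misses class [j + 2], it contains no chord and stays maximum in the chord graph. After
    the repair, a part with a chord consists of [a], [b], [c] only; all other parts are cliques of
    the digraph. *)
Lemma extended_cycle_S_paths (S : {set T}) :
  maximum_independent adj U S -> [disjoint class (j + 1)%R & S] ->
  [disjoint class (j + 2%:R)%R & S] -> #|class j| < #|class (j + 1)%R| ->
  exists f, S_paths U S f.
Proof.
move=> [SU iS maxS] d1 d2 card_lt.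
have [r rank_r] := rank_exists.
have chordS : maximum_independent chord_adj U S.
  split=> // [x y xS yS|S' S'U iS'].
    rewrite /chord_adj /= (negPf (iS x y xS yS)) /= /chord.
    have n2 z : z \in S -> (z \in class (j + 2%:R)%R) = false.
      by move=> zS; apply/negP => /(disjointFr d2); rewrite zS.
    by rewrite !n2 // !andbF.
  apply: maxS => // x y xS yS; have := iS' x y xS yS.
  by rewrite /chord_adj /= negb_or => /andP[].
have [f0 pf0] := perfect_clique_partition chord_adjxx
  (chord_perfect rank_r) chordS.
have [f [f1 f2 f3] fb] := chord_partition_repair SU d1 card_lt pf0.
exists f; split=> // s sS; set K := [set v in U | f v == s].
have KP v : v \in K -> v \in U /\ f v = s by rewrite inE => /andP[vU /eqP].
have cK u v : u \in K -> v \in K -> u != v -> chord_adj u v.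
  by move=> /KP[uU fu] /KP[vU fv]; apply: f3; rewrite ?fu ?fv.
have [[a aK [c cK' /andP[aj cj]]]|nochord] :=
    classic (exists2 a, a \in K & exists2 c, c \in K & chord a c); last first.
  apply: clique_traceable => u v uK vK uv; case/or3P: (cK u v uK vK uv) => // ch.
    by case: nochord; exists u => //; exists v.
  by case: nochord; exists v => //; exists u.
have [[aU fa] [cU fc]] := (KP a aK, KP c cK').
have [|b bj fba] := fb a c aj cj; first by rewrite fa fc.
have bK : b \in K by rewrite inE (classU bj) fba fa eqxx.
have e_ab : e a b := class_adj aj bj.
have e_bc : e b c by apply: class_adj bj _; rewrite shift1.
have ac : a != c.
  apply: contraTneq cj => <-; apply/negP => /classP[_]; have /classP[_ ->] := aj.
  by move/esym/eqP; rewrite shift_id.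
exists [:: a; b; c]; split.
- by rewrite /= !inE negb_or (arc_neq e_ab) ac (arc_neq e_bc).
- by rewrite /= e_ab e_bc.
move=> v; rewrite !inE -/K; apply/or3P/idP => [[] /eqP -> //|vK'].
- by have := aK; rewrite inE.
- by have := bK; rewrite inE.
- by have := cK'; rewrite inE.
have vK : v \in K by rewrite inE.
have [va|va] := eqVneq v a; first by constructor 1.
have [vc|vc] := eqVneq v c; first by constructor 3.
have [vb|vb] := eqVneq v b; first by constructor 2.
have [vU _] := KP v vK.
have vj := common_neighbour aj cj vU (cK v a vK aK va) (cK v c vK cK' vc).
by have := class_chord_independent vj bj; rewrite cK.
Qed.

End ExtendedCycle.

(** * Choice of the extended cycle and assembly of the path partition *)

Lemma induced_odd_dicycle_extended (U : {set T}) : induced_odd_dicycle U ->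
  exists m (A : {set T}) (l : T -> 'I_m.+4.+1), [/\ ~~ odd m, extended_cycle U A l
    & forall A' l', @extended_cycle m U A' l' -> #|A'| <= #|A|].
Proof.
move=> [n [c [on n5 cU ec]]].
case: n => [|[|[|[|[|m]]]]] // in on n5 ec.
have m_even : ~~ odd m by move: on; rewrite /= !negbK.
pose l x : 'I_m.+4.+1 := odflt ord0 [pick i : 'I_m.+4.+1 | c i == x].
pose A := [set c i | i : 'I_m.+4.+1].
have lP x : x \in A -> c (l x) = x.
  case/imsetP => i _ ->; rewrite /l; case: pickP => [k /eqP //|/(_ i)].
  by rewrite eqxx.
have succE (i k : 'I_m.+4.+1) : (k == i.+1 %[mod m.+4.+1]) = (k == (i + 1)%R).
  by rewrite -val_eqE /= (modn_small (ltn_ord k)) -(addn1 i) (@modn_small 1 m.+4.+1).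
(* The given dicycle is an extended cycle with classes of one vertex; it is then enlarged as far as
   possible. *)
have extA : extended_cycle U A l.
  split.
  - by apply/subsetP => x /imsetP[i _ ->].
  - by move=> x y xA yA; rewrite -{1}(lP x xA) -{1}(lP y yA) ec succE.
  - move=> i; exists (c i); first by apply/imsetP; exists i.
    have ciA : c i \in A by apply/imsetP; exists i.
    have : e (c i) (c (i + 1)%R) by rewrite ec succE.
    by rewrite -{1}(lP _ ciA) ec succE => /eqP/(addIr 1%R).
clear lP; clearbody A l.
have: exists A' (l' : T -> 'I_m.+4.+1), extended_cycle U A' l' /\
    forall B (k : T -> 'I_m.+4.+1), extended_cycle U B k -> #|B| <= #|A'|.
  have [N] := ubnP (#|U| - #|A|); elim: N A l extA => // N IH A l extA AN.
  apply: NNPP => no; apply: (no); exists A, l; split=> // B k extB.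
  rewrite leqNgt; apply/negP => lt; apply: no; apply: (IH B k extB).
  clear -AN lt extB; have [BU _ _] := extB; have := subset_leq_card BU; lia.
by move=> [A' [l' [extA' maxA']]]; exists m, A', l'.
Qed.

Lemma cyclic_sequence_descent m (h : 'I_m.+4.+1 -> nat) :
  exists i, h (i + 1)%R <= h i.
Proof.
case: (@arg_maxnP _ ord0 xpredT h isT) => i _ hi.
by exists i; apply: hi.
Qed.

(** Otherwise [h] alternates around a cycle of odd length. *)
Lemma odd_cyclic_two_free m (h : 'I_m.+4.+1 -> bool) : ~~ odd m ->
  (forall i, h i -> ~~ h (i + 1)%R) -> exists i, ~~ h i && ~~ h (i + 1)%R.
Proof.
move=> m_even sep; apply: NNPP => no.
have step i : h (i + 1)%R = ~~ h i.
  case: (boolP (h i)) => [/sep/negPf //|hi].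
  by apply: contraT => hi1; case: no; exists i; rewrite hi.
have alt t i : h (i + t%:R)%R = h i (+) odd t.
  elim: t => [|t IH]; first by rewrite addr0 addbF.
  by rewrite -natr1 addrA step IH /= addbN.
have := alt m.+4.+1 ord0; rewrite (@pchar_Zp m.+4.+1) // addr0 /= !negbK.
by rewrite m_even; case: (h _).
Qed.

Lemma out_semicomplete_S_paths (U S : {set T}) :
  maximum_independent adj U S -> exists f, S_paths U S f.
Proof.
have [N] := ubnP #|U|; elim: N => // N IH in U S *; rewrite ltnS => UN maxS.
have IHp (V R : {set T}) : V \proper U -> maximum_independent adj V R ->
    exists f, S_paths V R f.
  by move=> VU; apply: IH; apply: leq_trans (proper_card VU) UN.
have IHD (B : {set T}) x : x \in B -> x \in U -> [disjoint B & S] ->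
    exists f, S_paths (U :\: B) S f.
  move=> xB xU dBS; apply: IHp; last exact: maximum_independentD.
  by apply/properP; split; [exact: subsetDl|exists x; rewrite // inE xB].
have [odc|nodc] := classic (induced_odd_dicycle U); last first.
  have perfU : perfect adj U.
    move=> H k HU; apply: no_induced_odd_dicycle_colouring.
    by move=> odc; apply: nodc; apply: induced_odd_dicycleS odc.
  have [f [f1 f2 f3]] := perfect_clique_partition adjxx perfU maxS.
  exists f; split=> // s sS; apply: clique_traceable => x y.
  rewrite !inE => /andP[xU /eqP xs] /andP[yU /eqP ys]; apply: f3 => //.
  by rewrite xs.
have [SU iS _] := maxS.
have [m [A [l [m_even extA maxA]]]] := induced_odd_dicycle_extended odc.
have [/subsetP AU arcA pickA] := extA.
have next x : x \in A -> exists2 y, y \in A & e x y.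
  move=> xA; have [y yA ly] := pickA (l x + 1)%R.
  by exists y; rewrite // arcA // ly.
have dom v x : v \in U -> v \notin A -> x \in A -> e x v -> {in A, forall y, e y v}.
  move=> vU vA xA xv; exact: (dominated_by_cycle m_even extA maxA vU vA xA xv).
pose cl := class A l.
have clP i x : reflect (x \in A /\ l x = i) (x \in cl i) by apply: classP.
(* An out-neighbour of [h b] other than those in class [i + 1] lies outside [A], and is therefore
   dominated by [b] as well. *)
have append i : [disjoint cl (i + 1)%R & S] -> #|cl (i + 1)%R| <= #|cl i| ->
    exists f, S_paths U S f.
  move=> disj le; have [h [hA hI]] := injection_of_card le.
  have [b0 b0A lb0] := pickA (i + 1)%R.
  have [|f fP] := IHD (cl (i + 1)%R) b0 _ (AU b0 b0A) disj; first exact/clP.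
  apply: (S_paths_append_all _ disj _ hI _ _ fP).
  - by apply/subsetP => x /clP[/AU].
  - move=> b bj; have /clP[hbA lhb] := hA b bj; rewrite inE AU // andbT.
    by apply/negP => /clP[_]; rewrite lhb => /esym/eqP; rewrite shift1_id.
  - move=> b bj; have /clP[hbA lhb] := hA b bj; have /clP[bA lb] := bj.
    by rewrite arcA // lhb lb.
  - move=> b x bj; rewrite inE => /andP[xj xU].
    have /clP[hbA lhb] := hA b bj; have /clP[bA lb] := bj => hbx.
    have [xA|xA] := boolP (x \in A).
      case/negP: xj; apply/clP; split=> //.
      by move: hbx; rewrite arcA // lhb => /eqP.
    exact: (dom x (h b) xU xA hbA hbx b bA).
have [[w wU [wA [x xA xw]]]|closed] :=
    classic (exists2 w, w \in U & w \notin A /\ exists2 x, x \in A & e x w).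
  have [wS|wS] := boolP (w \in S); last first.
    have [||f fP] := IHD [set w] w _ wU; rewrite ?inE ?disjoints1 //.
    apply: (S_paths_insert (AU x xA) wU wS xw _ fP) => y yU xy.
    have [a aA xa] := next x xA.
    exact: out_near xa xy (dom w x wU wA xA xw a aA).
  (* All of [A] is adjacent to [w], so [S] misses every class, and some class is at most as large as
     its predecessor. *)
  have [i] := cyclic_sequence_descent (fun i => #|cl i|).
  apply: append; rewrite disjoint_subset; apply/subsetP => a /clP[aA _].
  apply/negP => aS; have := iS a w aS wS.
  by rewrite (arc_adj (dom w x wU wA xA xw a aA)).
have closedA : {in A & U, forall x v, e x v -> v \in A}.
  move=> x v xA vU xv; apply: contraT => vA; exfalso; apply: closed.
  by exists v => //; split=> //; exists x.
pose M := [set v in U | [exists a in A, connect (arc_in U) v a]].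
have MU : M \subset U by apply/subsetP => v; rewrite inE => /andP[].
(* No edge joins [M] to the rest, so the two sides are handled separately by induction. *)
have [MeU|MnU] := eqVneq M U; last first.
  have sep := basin_separated extA closedA.
  have [maxM maxD] := maximum_independent_split MU sep maxS.
  have [|f1 f1P] := IHp _ _ _ maxM; first by rewrite properEneq MnU.
  have [|f2 f2P] := IHp _ _ _ maxD; last exact: S_paths_split MU SU f1P f2P.
  have [a aA _] := pickA ord0; apply/properP; split; first exact: subsetDl.
  exists a; [exact: AU|rewrite !inE AU //= andbT negbK].
  by apply/exists_inP; exists a; rewrite ?connect0.
have reachA : {in U, forall v, exists2 a, a \in A & connect (arc_in U) v a}.
  by move=> v; rewrite -{1}MeU inE => /andP[_ /exists_inP].
have free i : ~~ ~~ [disjoint cl i & S] -> [disjoint cl i & S] by rewrite negbK.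
(* Consecutive classes are completely joined, so the stable set [S] cannot meet both. *)
have [|i /andP[/free d1 /free d2]] :=
    @odd_cyclic_two_free m (fun i => ~~ [disjoint cl i & S]) m_even.
  move=> i; rewrite negbK -setI_eq0 => /set0Pn[x]; rewrite inE => /andP[/clP[xA lx] xS].
  rewrite disjoint_subset; apply/subsetP => y /clP[yA ly]; apply/negP => yS.
  by have := iS x y xS yS; rewrite arc_adj // arcA // lx ly.
(* Class [i] is either appended to class [i - 1], or larger than it; then [j = i - 1] makes the two
   free classes [j + 1] and [j + 2]. *)
have [le|lt] := leqP #|cl i| #|cl (i - 1)%R|.
  by apply: (append (i - 1)%R); rewrite subrK.
apply: (extended_cycle_S_paths m_even extA closedA reachA (j := (i - 1)%R) maxS).
- by rewrite subrK.
- by rewrite (_ : (i - 1 + 2%:R) = i + 1)%R // -[2%:R%R]/(1 + 1)%R addrA subrK.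
- by rewrite subrK.
Qed.

End OutSemicomplete.

(** The local condition passes to the subdigraph induced on [A], where the preceding lemma is
    applied to the full vertex set; each fibre of [f] is traced by one path. *)
Theorem theorem36 (T : finType) (e : rel T) :
  irreflexive e ->
  arc_locally_out_semicomplete e ->
  ~ contains_induced_antidirected_odd_cycle e ->
  alpha_diperfect e.
Proof.
move=> eirr eout _ A S [iS maxS]; pose eA := induced e (A := A).
have irrA : irreflexive eA by move=> x; apply: eirr.
have outA : arc_locally_out_semicomplete eA.
  move=> u v uv x y ux vy; case: (eout _ _ uv _ _ ux vy) => [|/val_inj]; first by left.
  by right.
have [|f [f1 f2 f3]] := @out_semicomplete_S_paths _ eA irrA outA setT S.
  by split=> // S' _; apply: maxS.
have /fin_all_exists[q qP] s : exists q, s \in S ->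
    [/\ uniq q, sorted eA q & q =i [set v in setT | f v == s]].
  have [sS|_] := boolP (s \in S); last by exists [::].
  by have [q qP] := f3 s sS; exists q.
have qE s v : s \in S -> (v \in q s) = (f v == s).
  by move=> sS; have [_ _ ->] := qP s sS; rewrite !inE.
exists [seq q s | s <- enum S]; split; first split.
- apply/allP => p /mapP[s]; rewrite mem_enum => sS ->; rewrite /dipath.
  have [-> -> _] := qP s sS; rewrite !andbT.
  have : s \in q s by rewrite qE // f2.
  by case: (q s).
- move=> v; have fS : f v \in S by apply: f1.
  rewrite count_map (eq_in_count (a2 := pred1 (f v))); last first.
    by move=> s; rewrite mem_enum => sS; rewrite /= qE // eq_sym.
  by rewrite count_uniq_mem ?enum_uniq // mem_enum fS.
- move=> p /mapP[s]; rewrite mem_enum => sS ->.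
  rewrite (_ : _ :&: _ = [set s]) ?cards1 //; apply/setP => v; rewrite !inE qE //.
  apply/andP/eqP => [[/eqP fv vS]|->]; first by rewrite -fv f2.
  by rewrite f2 ?eqxx.
Qed.
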